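(* Let $p$ be a prime, let $n,c,t\ge 1$ be integers with $n\ge c$, and let $\alpha_1\ge\alpha_2\ge\dots\ge\alpha_t\ge 1$ be integers. Suppose that $(q,p)=1$ for all primes $q$ less than or equal to $n+c$. Let $$G\cong \mathbf{Z}_{p^{\alpha_1}}\stackrel{n}{*}\mathbf{Z}_{p^{\alpha_2}}\stackrel{n}{*}\cdots\stackrel{n}{*}\mathbf{Z}_{p^{\alpha_t}}$$ be the $n$th nilpotent product of cyclic groups of orders $p^{\alpha_1},\dots,p^{\alpha_t}$. Put $m=\sum_{i=1}^t\alpha_i$ and $g_m=\sum_{i=1}^{c}\chi_{n+i}(m)$. Then the $c$-nilpotent multiplier of $G$ satisfies $|\mathcal{N}_cM(G)|=p^{g_m}$ if and only if $$G\cong\underbrace{\mathbf{Z}_p\stackrel{n}{*}\mathbf{Z}_p\stackrel{n}{*}\cdots\stackrel{n}{*}\mathbf{Z}_p}_{m\text{ copies}}.$$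
   Context: $\mathbf{Z}_r$ is the cyclic group of order $r$. $\chi_c(k)$ denotes the number of basic commutators of weight $c$ on $k$ letters, given by Witt's formula $\chi_c(k)=\frac1c\sum_{d\mid c}\mu(d)k^{c/d}$, where $\mu$ is the Möbius function. Nilpotent product: for a family of groups $\{G_i\}_{i\in I}$ with free product $P=\prod^{*}_{i\in I}G_i$, let $[G_i]^*$ be the cartesian subgroup, i.e. the normal closure in $P$ of all $[G_i,G_j]$ with $i\ne j$ (the kernel of the natural map from $P$ to the direct product). The $n$th nilpotent product of the family is $P/(\gamma_{n+1}(P)\cap[G_i]^* )$, where $\gamma_k$ denotes the $k$th term of the lower central series. $c$-nilpotent multiplier: for a group $G\cong F/R$ with $F$ free, $\mathcal{N}_cM(G)=\dfrac{R\cap\gamma_{c+1}(F)}{[R,\,{}_cF]}$, where $[R,{}_cF]=[R,F,\dots,F]$ is the left-normed commutator subgroup with $F$ repeated $c$ times. This group is abelian and, up to isomorphism, independent of the free presentation of $G$. *)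

(* Defs.v *)
From HB Require Import structures.
From mathcomp Require Import all_boot all_order all_algebra all_fingroup.
From mathcomp Require Import generic_quotient.
From mathcomp Require Import boolp classical_sets functions cardinality.

Set Implicit Arguments.
Unset Strict Implicit.
Unset Printing Implicit Defensive.

Local Open Scope classical_set_scope.
Local Open Scope group_scope.
Local Open Scope quotient_scope.

Section Subgroups.
Variable G : groupType.
Implicit Types A B : set G.

Definition is_subgroup A : Prop :=
  [/\ A 1, forall x y, A x -> A y -> A (x * y) & forall x, A x -> A x^-1].

Definition is_normal A : Prop :=
  is_subgroup A /\ forall x y, A x -> A (x ^ y).

Definition generated_subgroup A : set G := smallest is_subgroup A.

Definition normal_closure A : set G := smallest is_normal A.

Definition commutator_subgroup A B : set G :=
  generated_subgroup [set z | exists2 x, A x & exists2 y, B y & z = [~ x, y]].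

(* [A, G, ..., G], left-normed, with G repeated c times *)
Definition iter_commutator (c : nat) A : set G :=
  iter c (fun B => commutator_subgroup B setT) A.

Lemma is_normalI A B : is_normal A -> is_normal B -> is_normal (A `&` B).
Proof.
move=> [[A1 AM AV] AJ] [[B1 BM BV] BJ]; split=> [|x y []]; last by split; auto.
by split=> // [x y [? ?] [? ?]|x [? ?]]; split; auto.
Qed.

Lemma is_subgroup_generated A : is_subgroup (generated_subgroup A).
Proof.
split=> [B [[B1 _ _] _] //|x y Ax Ay B AB|x Ax B AB];
  have [[_ BM BV] _] := AB.
- exact: BM (Ax B AB) (Ay B AB).
- exact: BV (Ax B AB).
Qed.

Lemma is_normal_normal_closure A : is_normal (normal_closure A).
Proof.
split=> [|x y Ax B AB]; last by have [[_ BJ] _] := AB; exact: BJ (Ax B AB).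
split=> [B [[[B1 _ _] _] _] //|x y Ax Ay B AB|x Ax B AB];
  have [[[_ BM BV] _] _] := AB.
- exact: BM (Ax B AB) (Ay B AB).
- exact: BV (Ax B AB).
Qed.

Lemma is_normal_commutator A B :
  is_normal A -> is_normal B -> is_normal (commutator_subgroup A B).
Proof.
move=> [_ AJ] [_ BJ]; split=> [|x y]; first exact: is_subgroup_generated.
have [C1 CM CV] := is_subgroup_generated
  [set z | exists2 x, A x & exists2 y, B y & z = [~ x, y]].
move=> Cx; apply: (Cx [set z | commutator_subgroup A B (z ^ y)]); split=> [|z].
  split=> [|u v Cu Cv|u Cu] /=; rewrite ?conj1g ?conjMg ?conjVg //.
  - exact: CM.
  - exact: CV.
move=> [a Aa [b Bb ->]] /= D [_ DAB]; apply: DAB.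
exists (a ^ y); first exact: AJ.
by exists (b ^ y); [exact: BJ | rewrite conjRg].
Qed.

Lemma is_normal_setT : is_normal [set: G].
Proof. by []. Qed.

Lemma is_normal_iter_commutator c A :
  is_normal A -> is_normal (iter_commutator c A).
Proof.
by move=> nA; elim: c => //= c IH; exact: is_normal_commutator is_normal_setT.
Qed.

End Subgroups.

(* gamma_k(G), numbered from gamma_1(G) = G; only used for k >= 1 *)
Definition lower_central (G : groupType) (k : nat) : set G :=
  iter_commutator k.-1 [set: G].
Arguments lower_central : clear implicits.

Lemma is_normal_lower_central (G : groupType) k :
  is_normal (lower_central G k).
Proof. exact/is_normal_iter_commutator/is_normal_setT. Qed.

Definition kernel (G H : groupType) (f : {multiplicative G -> H}) : set G :=
  f @^-1` [set 1].

Lemma is_normal_kernel (G H : groupType) (f : {multiplicative G -> H}) :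
  is_normal (kernel f).
Proof.
have f1 : f 1 = 1.
  by apply: (@mulgI _ (f 1)); rewrite -gmulfM !mulg1.
have fV x : f x^-1 = (f x)^-1.
  by apply: (@mulgI _ (f x)); rewrite -gmulfM !mulgV.
rewrite /kernel /preimage; split=> [|x y] /=.
  split=> //= [x y|x] ; first by rewrite gmulfM => -> ->; rewrite mulg1.
  by rewrite fV => ->; rewrite invg1.
by rewrite /conjg !gmulfM fV => ->; rewrite mul1g mulVg.
Qed.

Definition isomorphic (G H : groupType) : Prop :=
  exists f : {multiplicative G -> H}, bijective f.

Record normalSubgroup (G : groupType) := NormalSubgroup {
  normal_set :> set G;
  normal_setP : is_normal normal_set }.

Section Quotient.
Variables (G : groupType) (N : normalSubgroup G).

Definition coset_eq (x y : G) : bool := `[< normal_set N (x^-1 * y) >].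

Lemma coset_eq_equiv : equiv_class_of coset_eq.
Proof.
have [[N1 NM NV] _] := normal_setP N.
have sym x y : coset_eq x y -> coset_eq y x.
  by move=> /asboolP/NV; rewrite invgM invgK => ?; apply/asboolP.
split=> [x|x y|y x z /asboolP Nxy /asboolP Nyz].
- by apply/asboolP; rewrite mulVg.
- by apply/idP/idP; exact: sym.
- by apply/asboolP; have := NM _ _ Nxy Nyz; rewrite -mulgA mulVKg.
Qed.

Canonical coset_equiv := EquivRelPack coset_eq_equiv.

Definition quot_group : Type := {eq_quot coset_eq}.
HB.instance Definition _ := Choice.on quot_group.

Definition quot_map (x : G) : quot_group := \pi_({eq_quot coset_eq}) x.

Definition quot_one : quot_group := quot_map 1.
Definition quot_mul (X Y : quot_group) : quot_group :=
  quot_map (repr (X : {eq_quot coset_eq}) * repr (Y : {eq_quot coset_eq})).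
Definition quot_inv (X : quot_group) : quot_group :=
  quot_map (repr (X : {eq_quot coset_eq}))^-1.

Lemma quot_mapP x y :
  quot_map x = quot_map y <-> normal_set N (x^-1 * y).
Proof.
split=> [/eqmodP/asboolP //|Nxy].
exact/eqmodP/asboolP.
Qed.

Lemma quot_map_repr (X : quot_group) :
  quot_map (repr (X : {eq_quot coset_eq})) = X.
Proof. exact: reprK. Qed.

Lemma quot_map_surj (X : quot_group) : exists x, quot_map x = X.
Proof. by exists (repr (X : {eq_quot coset_eq})); exact: quot_map_repr. Qed.

Lemma quot_mapM x y :
  quot_map (x * y) = quot_mul (quot_map x) (quot_map y).
Proof.
have [[N1 NM NV] NJ] := normal_setP N.
rewrite /quot_mul; set x' := repr _; set y' := repr _.
have /quot_mapP Nx : quot_map x = quot_map x'.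
  by rewrite quot_map_repr.
have /quot_mapP Ny : quot_map y = quot_map y'.
  by rewrite quot_map_repr.
apply/quot_mapP; have := NM _ _ (NJ _ y Nx) Ny.
by rewrite conjgE invgM !mulgA mulgK.
Qed.

Lemma quot_mapV x : quot_map x^-1 = quot_inv (quot_map x).
Proof.
have [[N1 NM NV] NJ] := normal_setP N.
rewrite /quot_inv; set x' := repr _.
have /quot_mapP Nx : quot_map x = quot_map x'.
  by rewrite quot_map_repr.
apply/quot_mapP; have := NV _ (NJ _ x^-1 Nx).
by rewrite conjgE invgK -mulgA mulVKg invgM !invgK.
Qed.

Fact quot_mulA : associative quot_mul.
Proof.
move=> X Y Z; have [x <-] := quot_map_surj X.
have [y <-] := quot_map_surj Y; have [z <-] := quot_map_surj Z.
by rewrite -!quot_mapM mulgA.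
Qed.

Fact quot_mul1g : left_id quot_one quot_mul.
Proof.
by move=> X; have [x <-] := quot_map_surj X; rewrite -quot_mapM mul1g.
Qed.

Fact quot_mulg1 : right_id quot_one quot_mul.
Proof.
by move=> X; have [x <-] := quot_map_surj X; rewrite -quot_mapM mulg1.
Qed.

Fact quot_mulVg : left_inverse quot_one quot_inv quot_mul.
Proof.
move=> X; have [x <-] := quot_map_surj X.
by rewrite -quot_mapV -quot_mapM mulVg.
Qed.

Fact quot_mulgV : right_inverse quot_one quot_inv quot_mul.
Proof.
move=> X; have [x <-] := quot_map_surj X.
by rewrite -quot_mapV -quot_mapM mulgV.
Qed.

HB.instance Definition _ := isGroup.Build quot_group
  quot_mulA quot_mul1g quot_mulg1 quot_mulVg quot_mulgV.

HB.instance Definition _ :=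
  isMultiplicative.Build G quot_group quot_map quot_mapM.

End Quotient.

Section FreeProduct.
Variables (I : choiceType) (G : I -> groupType).

(* Words in the disjoint union of the G i, modulo the congruence that
   multiplies adjacent letters of the same factor and deletes identities. *)
Definition letter : Type := {i : I & G i}.
HB.instance Definition _ := gen_eqMixin letter.
HB.instance Definition _ := gen_choiceMixin letter.

Definition lett (i : I) (x : G i) : letter := existT (fun i => G i : Type) i x.

Inductive word_eq : seq letter -> seq letter -> Prop :=
| word_eq_refl u : word_eq u u
| word_eq_sym u v : word_eq u v -> word_eq v u
| word_eq_trans u v w : word_eq u v -> word_eq v w -> word_eq u w
| word_eq_one u v i : word_eq (u ++ lett (1 : G i) :: v) (u ++ v)
| word_eq_mul u v i (x y : G i) :
    word_eq (u ++ lett x :: lett y :: v) (u ++ lett (x * y) :: v).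

Definition word_eqb (u v : seq letter) : bool := `[< word_eq u v >].

Lemma word_eqb_equiv : equiv_class_of word_eqb.
Proof.
split=> [u|u v|v u w /asboolP uv /asboolP vw].
- exact/asboolP/word_eq_refl.
- by apply/asboolP/asboolP; exact: word_eq_sym.
- by apply/asboolP; exact: word_eq_trans uv vw.
Qed.

Canonical word_equiv := EquivRelPack word_eqb_equiv.

Definition free_product : Type := {eq_quot word_eqb}.
HB.instance Definition _ := Choice.on free_product.

Definition fp_class (u : seq letter) : free_product := \pi_({eq_quot word_eqb}) u.

Definition fp_repr (X : free_product) : seq letter :=
  repr (X : {eq_quot word_eqb}).

Definition letter_inv (a : letter) : letter :=
  let: existT i x := a in lett (x^-1 : G i).
Definition word_inv (u : seq letter) : seq letter := rev (map letter_inv u).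

Definition fp_one : free_product := fp_class [::].
Definition fp_mul (X Y : free_product) : free_product :=
  fp_class (fp_repr X ++ fp_repr Y).
Definition fp_inv (X : free_product) : free_product :=
  fp_class (word_inv (fp_repr X)).

Definition fp_inj (i : I) (x : G i) : free_product := fp_class [:: lett x].

Lemma word_eq_cat u u' v v' :
  word_eq u u' -> word_eq v v' -> word_eq (u ++ v) (u' ++ v').
Proof.
move=> uu' vv'; apply: (@word_eq_trans _ (u' ++ v)).
  elim: uu' {v' vv'} => [w|w w' _|w1 w2 w3 _ IH1 _|w1 w2 i|w1 w2 i x y].
  - exact: word_eq_refl.
  - exact: word_eq_sym.
  - exact: word_eq_trans.
  - rewrite -!catA; exact: word_eq_one.
  - rewrite -!catA; exact: word_eq_mul.
elim: vv' => [w|w w' _|w1 w2 w3 _ IH1 _|w1 w2 i|w1 w2 i x y].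
- exact: word_eq_refl.
- exact: word_eq_sym.
- exact: word_eq_trans.
- rewrite !catA; exact: word_eq_one.
- rewrite !catA; exact: word_eq_mul.
Qed.

Lemma word_inv_cat u v : word_inv (u ++ v) = word_inv v ++ word_inv u.
Proof. by rewrite /word_inv map_cat rev_cat. Qed.

Lemma word_inv_cons a u : word_inv (a :: u) = word_inv u ++ [:: letter_inv a].
Proof. by rewrite -cat1s word_inv_cat. Qed.

Lemma word_inv_eq u v : word_eq u v -> word_eq (word_inv u) (word_inv v).
Proof.
elim=> {u v} [w|w w' _|w1 w2 w3 _ IH1 _|w1 w2 i|w1 w2 i x y].
- exact: word_eq_refl.
- exact: word_eq_sym.
- exact: word_eq_trans.
- rewrite !word_inv_cat word_inv_cons /= invg1 -catA; exact: word_eq_one.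
- rewrite !word_inv_cat !word_inv_cons /= invgM -!catA; exact: word_eq_mul.
Qed.

Lemma word_eq_mulV u : word_eq (u ++ word_inv u) [::].
Proof.
elim: u => [|[i x] u IH]; first exact: word_eq_refl.
rewrite word_inv_cons /= catA.
apply: (@word_eq_trans _ (lett x :: [:: lett x^-1])).
  by apply: (@word_eq_cat [:: lett x] [:: lett x]);
    [exact: word_eq_refl | exact: word_eq_cat IH (word_eq_refl _)].
apply: word_eq_trans (word_eq_mul [::] [::] x x^-1) _.
by rewrite mulgV; exact: (word_eq_one [::] [::]).
Qed.

Lemma word_invK : involutive word_inv.
Proof.
elim=> [|[i x] u IH] //.
by rewrite word_inv_cons word_inv_cat IH /word_inv /= invgK.
Qed.

Lemma fp_classP u v : fp_class u = fp_class v <-> word_eq u v.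
Proof. by split=> [/eqmodP/asboolP //|uv]; exact/eqmodP/asboolP. Qed.

Lemma fp_reprK X : fp_class (fp_repr X) = X.
Proof. exact: reprK. Qed.

Lemma fp_class_cat u v : fp_class (u ++ v) = fp_mul (fp_class u) (fp_class v).
Proof.
by apply/fp_classP; apply: word_eq_cat; apply/fp_classP; rewrite fp_reprK.
Qed.

Lemma fp_class_inv u : fp_class (word_inv u) = fp_inv (fp_class u).
Proof.
by apply/fp_classP; apply: word_inv_eq; apply/fp_classP; rewrite fp_reprK.
Qed.

Fact fp_mulA : associative fp_mul.
Proof.
move=> X Y Z; rewrite -(fp_reprK X) -(fp_reprK Y) -(fp_reprK Z).
by rewrite -!fp_class_cat catA.
Qed.

Fact fp_mul1g : left_id fp_one fp_mul.
Proof. by move=> X; rewrite -(fp_reprK X) -fp_class_cat. Qed.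

Fact fp_mulg1 : right_id fp_one fp_mul.
Proof. by move=> X; rewrite -(fp_reprK X) -fp_class_cat cats0. Qed.

Fact fp_mulgV : right_inverse fp_one fp_inv fp_mul.
Proof.
move=> X; rewrite -(fp_reprK X) -fp_class_inv -fp_class_cat.
exact/fp_classP/word_eq_mulV.
Qed.

Fact fp_mulVg : left_inverse fp_one fp_inv fp_mul.
Proof.
move=> X; rewrite -(fp_reprK X) -fp_class_inv -fp_class_cat.
apply/fp_classP; rewrite -{2}(word_invK (fp_repr X)); exact: word_eq_mulV.
Qed.

HB.instance Definition _ := isGroup.Build free_product
  fp_mulA fp_mul1g fp_mulg1 fp_mulVg fp_mulgV.

Fact fp_injM i : {morph @fp_inj i : x y / x * y}.
Proof.
move=> x y; rewrite -[RHS]fp_class_cat; apply/fp_classP/word_eq_sym.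
exact: (word_eq_mul [::] [::]).
Qed.

HB.instance Definition _ i :=
  isMultiplicative.Build (G i) free_product (@fp_inj i) (@fp_injM i).

Definition cartesian_subgroup : set free_product :=
  normal_closure [set z | exists i j, i != j /\
    commutator_subgroup (range (@fp_inj i)) (range (@fp_inj j)) z].

Definition nilpotent_kernel (n : nat) : normalSubgroup free_product :=
  NormalSubgroup
    (is_normalI (is_normal_lower_central free_product n.+1)
                (is_normal_normal_closure _ : is_normal cartesian_subgroup)).

Definition nilpotent_product (n : nat) : groupType :=
  quot_group (nilpotent_kernel n).

End FreeProduct.

Definition is_free_basis (F : groupType) (X : Type) (b : X -> F) : Prop :=
  forall (H : groupType) (f : X -> H),
    exists2 phi : {multiplicative F -> H}, (forall x, phi (b x) = f x) &
      forall psi : {multiplicative F -> H},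
        (forall x, psi (b x) = f x) -> psi =1 phi.

Definition is_free_group (F : groupType) : Prop :=
  exists (X : Type) (b : X -> F), is_free_basis b.

Section Multiplier.
Variables (F G : groupType) (f : {multiplicative F -> G}) (c : nat).

Definition kernel_commutator : normalSubgroup F :=
  NormalSubgroup (is_normal_iter_commutator c (is_normal_kernel f)).

(* For a surjection f from a free group F onto G, with kernel R, this is
   (R \cap gamma_{c+1}(F)) / [R, _c F], realized as the image of
   R \cap gamma_{c+1}(F) in F / [R, _c F]. *)
Definition nilpotent_multiplier : set (quot_group kernel_commutator) :=
  @quot_map F kernel_commutator @` (kernel f `&` lower_central F c.+1).

End Multiplier.
Arguments nilpotent_multiplier {F G} f c.

(* The additive group of 'Z_r, which is Z/r for r > 1 only. *)
Definition cyclic_group (r : nat) : groupType := 'Z_r.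

Definition moebius (d : nat) : int :=
  if all (fun q => logn q d == 1%N) (primes d)
  then ((-1) ^+ size (primes d))%R else 0%R.

(* Number of basic commutators of weight c on k letters, by Witt's formula.
   The division by c is exact and the sum is nonnegative, so that both
   %/ and the absolute value are harmless. *)
Definition witt (c k : nat) : nat :=
  `|((\sum_(d <- divisors c) moebius d * (k ^ (c %/ d))%N%:Z)%R %/ c%:Z)%Z|%N.

(* Main.v *)
From HB Require Import structures.
Require Import Defs.
From mathcomp Require Import all_boot all_order all_algebra all_fingroup zify.
From mathcomp Require Import boolp classical_sets functions cardinality.

(** Write F for the free group, R for the kernel of F -> G, gamma_k for the
    lower central series of F and K for [R, F, ..., F] with c copies of F, so
    that the multiplier is (R meet gamma_(c+1)) / K.  The main result is the
    order of the multiplier, [card_nilpotent_multiplier]: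

      p ^ sum over the Lyndon words w of length n+1, ..., n+c on t letters of
          the least alpha l over the letters l of w.

    As cyclic groups are abelian, G is the universal group of class n
    generated by elements g_l of order dividing p ^ alpha l [np_class,
    np_lift].  Let y_l in F lift g_l.  The argument runs in F itself: for
    k > c, a k-fold commutator with an entry in R lies in K, so that, modulo
    K, gamma_k is generated by commutators in the y_l.

    Upper bound.  The factors gamma_k / gamma_(k+1) form a graded Lie ring, in
    which the standard bracketings of Lyndon words span: the classical
    straightening algorithm works on commutators in any group
    [gamma_lyndon_span].  For k > c the commutator of w has order dividing
    p ^ alpha l modulo K gamma_(k+1) for each letter l of w.  So the elements
    of gamma_k modulo K gamma_(k+1) are products of Lyndon commutators with
    exponents below the powers of p above [collection].

    Lower bound.  Over the integers modulo p ^ e, the elements 1 + x_l satisfy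
    (1 + x_l) ^ (p ^ a) = 1 up to degree n when e <= a, because n < p makes
    the binomial coefficients C(p ^ a, i), 0 < i <= n, vanish.  This represents
    G by noncommutative power series truncated at degree n; as F is free, the
    map lifts to untruncated series, R goes to series 1 + (degree > n), and K
    to series 1 + (degree > n+c) [magnus_exists].  The leading form of the
    commutator of w is the Lie polynomial of w, which is w plus larger words
    [lie_poly_triangular].  Hence the exponents are determined, modulo p ^ e
    for words whose letters satisfy e <= alpha l, and letting e vary they are
    determined completely [lyndon_prod_inj].  The same argument shows that
    R meet gamma_(c+1) lies in K gamma_(n+1) [kernel_deep]; the multiplier is
    thus the image of gamma_(n+1), counted weight by weight from n+c down to
    n+1.

    Comparison.  Witt's formula counts the Lyndon words [card_lyndon].  If all
    alpha l are 1, then t = m and the order is p ^ g_m.  In general, replace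
    each letter l by alpha l copies.  A Lyndon word w on t letters and an index
    j below all the alpha l of its letters give a Lyndon word on m letters,
    the j-th copy of w; these words are distinct, and if some alpha l > 1 they
    miss the word a ... a b where a and b are two copies of l.  So the order is
    strictly smaller than p ^ g_m unless all alpha l are 1
    [sum_word_exp_lt]. *)

Set Implicit Arguments.
Unset Strict Implicit.
Unset Printing Implicit Defensive.
Import Order.TTheory Order.DefaultSeqLexiOrder GRing.Theory.

(** * Lyndon words *)

Section LyndonWords.
Local Open Scope order_scope.

Section LexicographicOrder.
Context {d : Order.disp_t} {T : orderType d}.
Implicit Types u v w s t : seq T.

Lemma neq_nil w : (w != [::]) = (0 < size w)%N.
Proof. by case: w. Qed.

Lemma cat_split s t u v : s ++ t = u ++ v -> (size s <= size u)%N ->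
  exists2 r : seq T, u = s ++ r & t = r ++ v.
Proof.
elim: s u => [|x s IH] [|z u] //=; try by [move=> -> _; exists [::] | move=> -> _; exists (z :: u)].
by case=> -> /IH h /h[r -> ->]; exists r.
Qed.

Lemma lexi_cat2l s u v : (s ++ u < s ++ v) = (u < v).
Proof. by elim: s => //= x s <-; rewrite eqhead_ltxiE. Qed.

Lemma lexi_prefix u v : v != [::] -> u < u ++ v.
Proof. by move=> v0; rewrite -{1}[u]cats0 lexi_cat2l ltxi0s. Qed.

(** A comparison either comes from a proper prefix or is decided at some
    letter; in the second case it survives any continuation of the two words.
    All comparisons of concatenations below reduce to this alternative. *)
Lemma lexi_prefix_or u v : u < v ->
  (exists2 r : seq T, r != [::] & v = u ++ r) \/ (forall a b, u ++ a < v ++ b).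
Proof.
elim: u v => [|x u IH] [|y v] //=.
  by move=> _; left; exists (y :: v).
case: (eqVneq x y) => [<-|xy].
  rewrite eqhead_ltxiE => /IH[[r r0 ->]|h]; first by left; exists r.
  by right=> a b; rewrite eqhead_ltxiE.
by rewrite neqhead_ltxiE // => ltxy; right=> a b; rewrite neqhead_ltxiE.
Qed.

(** A word that is at least as long as v is not a proper prefix of v, so the
    comparison is decided at a letter. *)
Lemma lexi_cat u v a b : (size v <= size u)%N -> u < v -> u ++ a < v ++ b.
Proof.
move=> szvu /lexi_prefix_or[[r r0 vE]|//].
by move: szvu r0; rewrite vE size_cat; case: r vE => //= *; lia.
Qed.

Lemma lexi_catr u u' v : size u = size u' -> (u ++ v < u' ++ v) = (u < u').
Proof.
move=> szu; case: (ltgtP u u') => [ltu|ltu|->]; last by rewrite ltxx.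
  by rewrite lexi_cat ?szu.
by apply/negbTE; rewrite -leNgt ltW // lexi_cat ?szu.
Qed.

End LexicographicOrder.

Section Lyndon.
Context {d : Order.disp_t} {T : orderType d}.
Implicit Types u v w s t : seq T.

Definition lyndon w : bool :=
  (w != [::]) && all (fun i => w < drop i w) (iota 1 (size w).-1).

Lemma lyndonP w :
  reflect (w != [::] /\
           forall s t, w = s ++ t -> s != [::] -> t != [::] -> w < t)
          (lyndon w).
Proof.
apply: (iffP andP) => -[w0 H]; split=> //.
  move=> s t wE s0 t0; have := allP H (size s).
  rewrite wE drop_size_cat // mem_iota size_cat; apply.
  move: s0 t0; rewrite !neq_nil; lia.
apply/allP => i; rewrite mem_iota => iw.
have szw : (0 < size w)%N by rewrite -neq_nil.
apply: (H (take i w) (drop i w)); rewrite ?cat_take_drop // neq_nil.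
  by rewrite size_take; case: ifP; lia.
by rewrite size_drop; lia.
Qed.

Lemma lyndon_neq0 w : lyndon w -> w != [::].
Proof. by case/andP. Qed.

Lemma lyndon_suffix s t : lyndon (s ++ t) -> s != [::] -> t != [::] -> s ++ t < t.
Proof. by case/lyndonP => _; apply. Qed.

(** Since t is shorter than s ++ t, the inequality s ++ t < t is decided at a
    letter of t and persists after appending s. *)
Lemma lyndon_rot s t :
  lyndon (s ++ t) -> s != [::] -> t != [::] -> s ++ t < t ++ s.
Proof.
move=> Lst s0 t0; have /lexi_prefix_or[[r _ tE]|h] := lyndon_suffix Lst s0 t0.
  move: s0; rewrite neq_nil; move: (congr1 (@size T) tE).
  by rewrite !size_cat; lia.
by have := h [::] s; rewrite cats0.
Qed.

(** If a proper suffix v of w = u ++ v were smaller than w, it would have to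
    be a prefix, w = v ++ r; comparing w with its rotations v ++ u and r ++ v
    gives both r < u and u < r. *)
Lemma rot_lyndon w : w != [::] ->
  (forall s t, w = s ++ t -> s != [::] -> t != [::] -> w < t ++ s) -> lyndon w.
Proof.
move=> w0 H; apply/lyndonP; split=> // u v wE u0 v0.
case: (ltgtP w v) => // [vw|wv]; last first.
  move: u0; rewrite neq_nil; move: (congr1 (@size T) wE).
  by rewrite wv size_cat; lia.
have [[r r0 wvr]|/(_ u [::])] := lexi_prefix_or vw; last first.
  by rewrite cats0 => /lt_trans/(_ (H _ _ wE u0 v0)); rewrite ltxx.
(* w = u ++ v = v ++ r is now squeezed between its rotations by u and by v *)
have sz : size r = size u.
  by have := congr1 (@size T) wE; rewrite wvr !size_cat; lia.
have := H _ _ wE u0 v0; rewrite wvr lexi_cat2l => ru.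
have := H _ _ wvr v0 r0; rewrite wE lexi_catr // => ur.
by have := lt_trans ru ur; rewrite ltxx.
Qed.

Lemma lyndon_cat u v : lyndon u -> lyndon v -> u < v -> lyndon (u ++ v).
Proof.
move=> Lu Lv uv.
have u0 := lyndon_neq0 Lu; have v0 := lyndon_neq0 Lv.
have uvv : u ++ v < v.
  have [[r r0 vE]|/(_ v [::])] := lexi_prefix_or uv; last by rewrite cats0.
  by rewrite {2}vE lexi_cat2l vE lyndon_suffix // -vE.
apply/lyndonP; split; first by case: (u) u0.
move=> s t uvE s0 t0.
have [szs|szs] := leqP (size s) (size u).
  have [r uE tE] := cat_split (esym uvE) szs.
  case: (eqVneq r [::]) => [rE|r0]; first by rewrite tE rE.
  rewrite tE; apply: lexi_cat; first by rewrite uE size_cat leq_addl.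
  by rewrite {1}uE lyndon_suffix // -uE.
have [r sE vE] := cat_split uvE (ltnW szs).
apply: (lt_trans uvv); rewrite {1}vE lyndon_suffix // -?vE // neq_nil.
by move: szs; rewrite sE size_cat; lia.
Qed.

Fixpoint min_suffix s :=
  if s is x :: s' then
    if s' is [::] then s else if s < min_suffix s' then s else min_suffix s'
  else [::].

Lemma min_suffixP s : s != [::] ->
  min_suffix s != [::] /\ exists r : seq T, s = r ++ min_suffix s.
Proof.
elim: s => //= x [|y s] IH _; first by split=> //; exists [::].
have [//|m0 [r rE]] := IH; case: ifP => _; first by split=> //; exists [::].
by split=> //; exists (x :: r); rewrite {1}rE.
Qed.

Lemma min_suffix_le s r t : s = r ++ t -> t != [::] -> min_suffix s <= t.
Proof.
elim: s r => [|x s IH] r sE t0; first by rewrite [min_suffix _]/= le0x.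
case: r sE => [|y r] /=.
  move=> <-; case: s {IH} => // y s; case: ifP => // /negbT.
  by rewrite -leNgt.
case=> _ sE; have := IH _ sE t0.
case: s sE IH => [|z s] sE _; first by case: r t t0 sE => [|? ?] [].
by move=> mt; case: ifP => // xm; apply: le_trans mt; exact: ltW.
Qed.

(** The standard factorization: the right factor is the smallest proper
    suffix of w (which is also its longest proper Lyndon suffix). *)
Definition std_right w := min_suffix (behead w).
Definition std_left w := take (size w - size (std_right w)) w.

Section Standard.
Variable w : seq T.
Hypothesis (w1 : (1 < size w)%N).

Lemma std_cat : std_left w ++ std_right w = w.
Proof.
rewrite /std_left /std_right; case: w w1 => //= x s s0.
have /min_suffixP[_ [r rE]] : s != [::] by rewrite neq_nil.
set m := min_suffix s in rE *; rewrite rE -cat_cons take_size_cat //=.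
by rewrite size_cat; lia.
Qed.

Lemma std_right_neq0 : std_right w != [::].
Proof.
rewrite /std_right; case: w w1 => //= x s s0.
by have /min_suffixP[] : s != [::] by rewrite neq_nil.
Qed.

Lemma size_std_right : (0 < size (std_right w) < size w)%N.
Proof.
rewrite -neq_nil std_right_neq0 /=.
rewrite /std_right; case: w w1 => //= x s s0.
have /min_suffixP[_ [r rE]] : s != [::] by rewrite neq_nil.
by rewrite {2}rE size_cat; lia.
Qed.

Lemma size_std_left : (0 < size (std_left w) < size w)%N.
Proof.
have := size_std_right; have := congr1 (@size T) std_cat.
by rewrite size_cat; lia.
Qed.

Lemma std_left_neq0 : std_left w != [::].
Proof. by rewrite neq_nil; case/andP: size_std_left. Qed.

Lemma std_right_le s t : w = s ++ t -> s != [::] -> t != [::] -> std_right w <= t.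
Proof.
case: s => // x s ->; rewrite /std_right /= => _; exact: min_suffix_le.
Qed.

Lemma lyndon_std_right : lyndon (std_right w).
Proof.
apply/lyndonP; split=> [|s t rE s0 t0]; first exact: std_right_neq0.
rewrite lt_neqAle; apply/andP; split.
  apply/negP => /eqP/(congr1 (@size T)); rewrite rE size_cat.
  by move: s0; rewrite neq_nil; lia.
apply: (@std_right_le (std_left w ++ s)); rewrite ?t0 //.
  by rewrite -catA -rE std_cat.
by case: (std_left w) std_left_neq0.
Qed.

(** If a proper suffix t of the left factor were a prefix of it, then, writing
    the left factor as t ++ r, the inequality w < t ++ std_right w would give
    r ++ std_right w < std_right w, against the minimality of std_right w. *)
Lemma lyndon_std_left : lyndon w -> lyndon (std_left w).
Proof.
move=> Lw; apply/lyndonP; split=> [|s t lE s0 t0]; first exact: std_left_neq0.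
have wE : w = s ++ (t ++ std_right w) by rewrite catA -lE std_cat.
have tr0 : t ++ std_right w != [::] by case: (t) t0.
have ltw := lyndon_suffix; have := ltw s (t ++ std_right w).
rewrite -wE => /(_ Lw s0 tr0) wt.
case: (ltgtP (std_left w) t) => // [tl|lt]; last first.
  move: s0; rewrite neq_nil; move: (congr1 (@size T) lE).
  by rewrite lt size_cat; lia.
have [[r r0 lE']|/(_ (std_right w) (std_right w))] := lexi_prefix_or tl; last first.
  by rewrite std_cat => /(lt_trans wt); rewrite ltxx.
move: wt; rewrite -{1}std_cat lE' -catA lexi_cat2l => rr.
have wE' : w = t ++ (r ++ std_right w) by rewrite catA -lE' std_cat.
have rr0 : r ++ std_right w != [::] by case: (r) r0.
by have := std_right_le wE' t0 rr0; rewrite leNgt rr.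
Qed.

Lemma std_lt : lyndon w -> std_left w < std_right w.
Proof.
move=> Lw; have := @lyndon_suffix (std_left w) (std_right w).
rewrite std_cat => /(_ Lw std_left_neq0 std_right_neq0); apply: le_lt_trans.
by rewrite -{2}std_cat ltW // lexi_prefix // std_right_neq0.
Qed.

End Standard.

(** The straightening criterion: when u is a letter or when v does not exceed
    the right factor of u, every suffix of u ++ v that cuts u is larger than
    v, so (u, v) is the standard factorization of u ++ v. *)
Lemma std_cat_eq u v : lyndon u -> lyndon v ->
  (size u <= 1)%N || (v <= std_right u) ->
  std_left (u ++ v) = u /\ std_right (u ++ v) = v.
Proof.
move=> Lu Lv H; have u0 := lyndon_neq0 Lu; have v0 := lyndon_neq0 Lv.
have uv1 : (1 < size (u ++ v))%N.
  by move: u0 v0; rewrite size_cat !neq_nil; lia.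
suff rE : std_right (u ++ v) = v.
  by split=> //; rewrite /std_left rE size_cat addnK take_size_cat.
have uvE := std_cat uv1; have l0 := std_left_neq0 uv1.
have r0 := std_right_neq0 uv1.
apply: le_anti; rewrite (std_right_le (s := u) (t := v)) //=.
set s := std_left _ in uvE l0; set t := std_right _ in uvE r0 *.
have [szs|szs] := leqP (size s) (size u); last first.
  have [r sE vE] := cat_split (esym uvE) (ltnW szs).
  rewrite {1}vE ltW // lyndon_suffix // -?vE // neq_nil.
  by move: szs; rewrite sE size_cat; lia.
have [r uE tE] := cat_split uvE szs.
case: (eqVneq r [::]) => [rE|nr0]; first by rewrite tE rE.
have u1 : (1 < size u)%N by move: l0 nr0; rewrite uE size_cat !neq_nil; lia.
case/orP: H => [|vu]; first by rewrite leqNgt u1.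
apply: (le_trans vu); rewrite tE; apply: (le_trans (std_right_le uE l0 nr0)).
by rewrite ltW // lexi_prefix.
Qed.

Lemma lyndon_ind (P : seq T -> Prop) :
  (forall x, P [:: x]) ->
  (forall w, lyndon w -> (1 < size w)%N ->
     lyndon (std_left w) -> lyndon (std_right w) ->
     P (std_left w) -> P (std_right w) -> P w) ->
  forall w, lyndon w -> P w.
Proof.
move=> P1 PS w; have [n] := ubnP (size w); elim: n w => // n IH w szw Lw.
have [w1|w1] := ltnP 1 (size w).
  have Ll := lyndon_std_left w1 Lw; have Lr := lyndon_std_right w1.
  have /andP[_ szl] := size_std_left w1; have /andP[_ szr] := size_std_right w1.
  by apply: PS => //; apply: IH => //; lia.
by case: w w1 Lw {szw} => [|x [|]] //.
Qed.

Section Bracket.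
Variables (G : Type) (op : G -> G -> G) (y : T -> G) (g0 : G).

(** The standard bracketing of a word, for any binary operation: it yields
    the Lyndon commutators in a group and the Lie polynomials in a ring.  The
    number n bounds the depth of the recursion. *)
Fixpoint bracket_rec n w : G :=
  if n is n'.+1 then
    match w with
    | [::] => g0
    | [:: x] => y x
    | _ => op (bracket_rec n' (std_left w)) (bracket_rec n' (std_right w))
    end
  else g0.

Definition bracket w := bracket_rec (size w) w.

Lemma bracket_recE n w : (size w <= n)%N -> bracket_rec n w = bracket w.
Proof.
rewrite /bracket; have [m] := ubnP (size w).
elim: m n w => // m IH [|n] [|x [|z w]] //; set w' := [:: x, z & w] => szm szn.
have w1 : (1 < size w')%N by [].
have /andP[_ szl] := size_std_left w1; have /andP[_ szr] := size_std_right w1.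
have E : size w' = (size w).+2 by [].
have F k : bracket_rec k.+1 w' =
  op (bracket_rec k (std_left w')) (bracket_rec k (std_right w')) by [].
rewrite E !F; rewrite E in szm szn szl szr.
rewrite !(IH n); [|lia..]; rewrite !(IH (size w).+1) //; lia.
Qed.

Lemma bracketE w : (1 < size w)%N ->
  bracket w = op (bracket (std_left w)) (bracket (std_right w)).
Proof.
move=> w1.
have /andP[_ szl] := size_std_left w1; have /andP[_ szr] := size_std_right w1.
have E : bracket w = op (bracket_rec (size w).-1 (std_left w))
                        (bracket_rec (size w).-1 (std_right w)).
  by rewrite {1}/bracket; case: (w) w1 => [|x [|z s]].
by rewrite E !bracket_recE //; lia.
Qed.

End Bracket.

End Lyndon.

End LyndonWords.

(** * Counting Lyndon words by Witt's formula *)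

Section CountingLyndonWords.
Local Open Scope order_scope.

Section Moebius.
Local Open Scope ring_scope.

Local Open Scope nat_scope.

Lemma moebius_mul_prime p d : prime p -> 0 < d -> ~~ (p %| d) ->
  moebius (p * d) = (- moebius d)%R.
Proof.
move=> pp d0 npd; have p0 := prime_gt0 pp.
have perm : perm_eq (primes (p * d)) (p :: primes d).
  apply: uniq_perm; rewrite ?primes_uniq //= ?primes_uniq ?andbT.
    by rewrite mem_primes pp d0 npd.
  by move=> q; rewrite primesM // inE primes_prime // inE.
rewrite /moebius (perm_all _ perm) (perm_size perm) /=.
have -> : logn p (p * d) == 1.
  by rewrite lognM // logn_prime // eqxx (lognE p d) (negbTE npd) !andbF.
have -> : all (fun q => logn q (p * d) == 1) (primes d) =
          all (fun q => logn q d == 1) (primes d).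
  apply: eq_in_all => q; rewrite mem_primes => /and3P[qp _ qd].
  rewrite lognM // logn_prime //.
  by case: (eqVneq q p) qd => [->|//]; rewrite (negbTE npd).
by rewrite andTb; case: ifP => _; rewrite ?oppr0 // exprS mulN1r.
Qed.

Lemma moebius_sqr p d : prime p -> 1 < logn p d -> moebius d = 0%R.
Proof.
move=> pp l1; rewrite /moebius; case: ifP => // /allP /(_ p).
rewrite -logn_gt0 (ltnW l1) => /(_ isT) /eqP l; by rewrite l in l1.
Qed.

(** Fix a prime p dividing n.  The divisors that p ^ 2 divides contribute
    nothing, and d and p * d cancel when p does not divide d. *)
Lemma sum_moebius n : 0 < n ->
  (\sum_(d <- divisors n) moebius d)%R = (n == 1)%:Z.
Proof.
move=> n0; have [n1|n1] := leqP n 1.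
  by rewrite (_ : n = 1) ?big_seq1 //; lia.
have -> : (n == 1) = false by lia.
set p := pdiv n; have pp : prime p := pdiv_prime n1.
have pn : p %| n := pdiv_dvd n.
have p0 := prime_gt0 pp.
rewrite (bigID (fun d => p %| d)) /= -[X in (X + _)%R = _]big_filter.
rewrite -[X in (_ + X)%R = _]big_filter.
rewrite big_filter (bigID (fun d => 1 < logn p d)) /= big1; last first.
  by move=> d /andP[_]; exact: moebius_sqr.
rewrite add0r -big_filter.
have pe : perm_eq [seq d <- divisors n | (p %| d) && ~~ (1 < logn p d)]
                  [seq p * d | d <- [seq d <- divisors n | ~~ (p %| d)]].
  apply: uniq_perm; first by rewrite filter_uniq ?divisors_uniq.
    rewrite map_inj_uniq ?filter_uniq ?divisors_uniq // => x y /eqP.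
    by rewrite eqn_pmul2l // => /eqP.
  move=> d; rewrite mem_filter -dvdn_divisors //.
  apply/idP/mapP => [/andP[/andP[pd l1] dn]|[e]].
    have d0 : 0 < d := dvdn_gt0 n0 dn.
    exists (d %/ p); last by rewrite mulnC divnK.
    rewrite mem_filter -dvdn_divisors // (dvdn_trans (dvdn_div pd)) // andbT.
    apply: contra l1 => pdp.
    rewrite -(@pfactor_dvdn p 2) // -(divnK pd) expnS expn1.
    exact: dvdn_mul.
  rewrite mem_filter -dvdn_divisors // => /andP[npe en] ->.
  have e0 : 0 < e := dvdn_gt0 n0 en.
  rewrite dvdn_mulr //= Gauss_dvd ?prime_coprime // pn en andbT.
  by rewrite lognM // logn_prime // eqxx (lognE p e) (negbTE npe) !andbF.
rewrite (perm_big _ pe) /= big_map -big_split big_seq big1 //= => d.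
rewrite mem_filter -dvdn_divisors // => /andP[npd dn].
by rewrite moebius_mul_prime ?(dvdn_gt0 n0 dn) // addNr.
Qed.

Lemma moebius_inversion n (f h : nat -> int) : 0 < n ->
  (forall d, (d %| n)%N -> f d = \sum_(e <- divisors d) h e)%R ->
  h n = (\sum_(d <- divisors n) moebius d * f (n %/ d)%N)%R.
Proof.
move=> n0 fE.
have subdiv (F : nat -> int) m : m %| n ->
    (\sum_(d <- divisors m) F d = \sum_(d <- divisors n | (d %| m)%N) F d)%R.
  move=> mn; have m0 := dvdn_gt0 n0 mn.
  rewrite -[RHS]big_filter; apply: perm_big; apply: uniq_perm.
  - exact: divisors_uniq.
  - by rewrite filter_uniq ?divisors_uniq.
  move=> d; rewrite mem_filter -!dvdn_divisors //.
  by case: (boolP (d %| m)) => // /dvdn_trans->.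
transitivity (\sum_(d <- divisors n) \sum_(e <- divisors n)
    if (d * e %| n)%N then moebius d * h e else 0)%R; last first.
  rewrite [RHS]big_seq [LHS]big_seq; apply: eq_bigr => d.
  rewrite -dvdn_divisors // => dn; have d0 := dvdn_gt0 n0 dn.
  have ndn : n %/ d %| n by rewrite dvdn_div.
  rewrite fE // (subdiv _ (n %/ d)) // mulr_sumr [RHS]big_mkcond; apply: eq_bigr => e _.
  by rewrite dvdn_divRL // mulnC.
rewrite exchange_big /= (bigD1_seq n) ?divisors_uniq ?divisors_id //=.
rewrite [X in (_ + X)%R]big_seq_cond [X in (_ + X)%R]big1 ?addr0; last first.
  move=> e; rewrite -dvdn_divisors // => /andP[en ne].
  have e0 := dvdn_gt0 n0 en.
  transitivity (\sum_(d <- divisors (n %/ e)) moebius d * h e)%R.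
    rewrite (subdiv _ (n %/ e)) ?dvdn_div // [RHS]big_mkcond; apply: eq_bigr => d _.
    by rewrite dvdn_divRL.
  rewrite -mulr_suml sum_moebius ?divn_gt0 ?(dvdn_leq n0) //.
  case: eqP => [ne1|]; last by rewrite mul0r.
  by move: ne; rewrite -{1}(divnK en) ne1 mul1n eqxx.
transitivity (\sum_(d <- divisors (n %/ n)) moebius d * h n)%R.
  by rewrite -mulr_suml divnn n0 sum_moebius // mul1r.
rewrite (subdiv _ (n %/ n)) ?dvdn_div // [LHS]big_mkcond; apply: eq_bigr => d _.
by rewrite dvdn_divRL.
Qed.

End Moebius.

(** Words that commute are powers of a common word; here the length of w is
    a multiple of that of v, so w is a power of v. *)
Lemma commuting_power (T : eqType) q (v w : seq T) :
  size w = (q * size v)%N -> w ++ v = v ++ w -> w = flatten (nseq q v).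
Proof.
elim: q w => [|q IH] w szw E; first by apply: size0nil; rewrite szw.
have wE : w = v ++ drop (size v) w.
  have := congr1 (take (size v)) E.
  rewrite takel_cat ?szw ?mulSn ?leq_addr // take_size_cat // => {1}<-.
  by rewrite cat_take_drop.
rewrite wE /=; congr (_ ++ _); apply: IH; first by rewrite size_drop szw mulSn addKn.
by move: E; rewrite {1 2}wE -catA => /eqP; rewrite eqseq_cat // eqxx => /eqP.
Qed.

Lemma Posz_sum (I : Type) (r : seq I) (P : pred I) (F : I -> nat) :
  Posz (\sum_(i <- r | P i) F i)%N = (\sum_(i <- r | P i) Posz (F i))%R.
Proof. exact: (big_morph Posz PoszD (erefl _)). Qed.

Section CountLyndon.
Context {disp : Order.disp_t} {T : finOrderType disp}.
Variable n : nat.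
Hypothesis n_gt0 : (0 < n)%N.
Local Open Scope ring_scope.
Local Open Scope nat_scope.
Let W := (n.-tuple T)%type.

Definition rot1 (w : W) : W := [tuple of rot 1 w].

Lemma rot1_inj : injective rot1.
Proof. by move=> u v /(congr1 val) /rot_inj /val_inj. Qed.

Lemma val_iter_rot1 i (w : W) : i <= n -> val (iter i rot1 w) = rot i w.
Proof.
elim: i => [|i IH] szi; first by rewrite rot0.
by rewrite rotS ?size_tuple // -IH ?(ltnW szi).
Qed.

Lemma iter_rot1_id w : iter n rot1 w = w.
Proof. by apply: val_inj; rewrite val_iter_rot1 // -{1}(size_tuple w) rot_size. Qed.

(** The rotations that fix w form a subgroup of the integers, generated by
    the size of the orbit of w. *)
Lemma iter_rot1_order w i : (iter i rot1 w == w) = (fingraph.order rot1 w %| i).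
Proof.
have itmul q : iter (q * fingraph.order rot1 w) rot1 w = w.
  elim: q => // q IH; rewrite mulSn iterD IH; exact: iter_order rot1_inj w.
apply/eqP/dvdnP => [iw|[q ->]]; last exact: itmul.
exists (i %/ fingraph.order rot1 w); rewrite {1}(divn_eq i (fingraph.order rot1 w)).
have o0 := fingraph.order_gt0 rot1 w.
suff -> : i %% fingraph.order rot1 w = 0 by rewrite addn0.
rewrite -(@findex_iter _ rot1 w (i %% fingraph.order rot1 w)) ?ltn_mod //.
have -> : iter (i %% fingraph.order rot1 w) rot1 w = w.
  by rewrite -[in RHS]iw {2}(divn_eq i (fingraph.order rot1 w)) addnC iterD itmul.
exact: findex0.
Qed.

(** A word is fixed by the rotation by d exactly when it is a power of its
    prefix of length d. *)
Lemma card_period_tuple d : d %| n ->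
  #|[pred w : W | iter d rot1 w == w]| = #|T| ^ d.
Proof.
move=> dn; have [q nE] := dvdnP dn.
have d0 := dvdn_gt0 n_gt0 dn; have q0 : 0 < q by lia.
have sz (v : d.-tuple T) : size (flatten (nseq q (val v))) == n.
  by rewrite size_flatten /shape map_nseq sumn_nseq size_tuple nE mulnC.
pose pw v : W := Tuple (sz v).
have pwI : injective pw.
  move=> u v /(congr1 val) /= E; apply: val_inj => /=.
  have [q' qE] : exists q', q = q'.+1 by exists q.-1; lia.
  by have := congr1 (take d) E; rewrite qE /= !take_size_cat ?size_tuple.
rewrite -card_tuple -(fintype.card_image pwI).
apply: eq_card => w; rewrite inE; apply/eqP/fintype.imageP => [rw|[v _ ->]].
  have szw : size (take d w) == d by rewrite size_takel // size_tuple (dvdn_leq n_gt0).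
  exists (Tuple szw) => //; apply: val_inj => /=.
  have dw : d <= size w by rewrite size_tuple (dvdn_leq n_gt0).
  have := congr1 val rw; rewrite val_iter_rot1 ?(dvdn_leq n_gt0) // /rot => E.
  rewrite -{1}(cat_take_drop d w) -(prednK q0) /=; congr (_ ++ _).
  have szt := eqP szw; apply: commuting_power.
    by rewrite size_drop szt size_tuple nE; nia.
  by rewrite E cat_take_drop.
apply: val_inj; rewrite val_iter_rot1 ?(dvdn_leq n_gt0) //= -(prednK q0) /=.
rewrite -{1}(size_tuple v) rot_size_cat.
elim: q.-1 => [|m IH] /=; first by rewrite cats0.
by rewrite -catA IH.
Qed.

(** A primitive word has n distinct rotations, exactly one of which is
    smaller than all the others, that is, Lyndon. *)
Lemma card_primitive :
  #|[pred w : W | fingraph.order rot1 w == n]| = n * #|[pred w : W | lyndon w]|.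
Proof.
have iter_inj m : injective (iter m rot1).
  by elim: m => [|m IH] a b //= /rot1_inj/IH.
have lyn_lt (w : W) i : lyndon w -> 0 < i < n -> (w < iter i rot1 w :> seq T)%O.
  move=> Lw i0; rewrite val_iter_rot1 /rot; last by lia.
  rewrite -{1}(cat_take_drop i w); apply: lyndon_rot; rewrite ?cat_take_drop //.
    by rewrite neq_nil size_takel ?size_tuple; lia.
  by rewrite neq_nil size_drop size_tuple; lia.
have primE (w : W) i j : fingraph.order rot1 w = n -> i < n -> j < n ->
    iter i rot1 w = iter j rot1 w -> i = j.
  move=> ow in_ jn E.
  by rewrite -(@findex_iter _ rot1 w i) ?ow // E findex_iter ?ow.
have lyn_prim (w : W) : lyndon w -> fingraph.order rot1 w = n.
  move=> Lw; have on : fingraph.order rot1 w %| n by rewrite -iter_rot1_order iter_rot1_id.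
  have o0 := fingraph.order_gt0 rot1 w; have := dvdn_leq n_gt0 on.
  rewrite leq_eqVlt => /orP[/eqP //|on'].
  have := lyn_lt w (fingraph.order rot1 w) Lw; rewrite o0 on' => /(_ isT).
  by rewrite iter_order ?ltxx //; exact: rot1_inj.
pose f (x : 'I_n * W) := iter x.1 rot1 x.2.
have finj : {in [pred x : 'I_n * W | lyndon x.2] &, injective f}.
  move=> [i u] [j v]; rewrite !inE /f /= => Lu Lv.
  wlog ij : i j u v Lu Lv / i <= j.
    move=> H; case: (leqP i j) => ij; first exact: H.
    by move=> E; apply/esym; apply: H (esym E) => //; exact: ltnW.
  rewrite -(subnKC ij) iterD => /iter_inj uE.
  have [ji|ji] := posnP (j - i).
    rewrite uE ji; congr (_, _); apply: val_inj => /=.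
    by move: ij ji; lia.
  have jin : j - i < n by have := ltn_ord j; lia.
  have vE : v = iter (n - (j - i)) rot1 u.
    by rewrite uE -iterD subnK ?iter_rot1_id // ltnW.
  have /(lyn_lt _ _ Lv) : 0 < j - i < n by rewrite ji jin.
  rewrite -uE => vu; have /(lyn_lt _ _ Lu) : 0 < n - (j - i) < n by lia.
  by rewrite -vE => /(lt_trans vu); rewrite ltxx.
transitivity #|predX {: 'I_n} [pred w : W | lyndon w]|; last first.
  by rewrite cardX card_ord.
transitivity #|[pred x : 'I_n * W | lyndon x.2]|; last first.
  by apply: eq_card => -[i w]; rewrite !inE.
rewrite -(card_in_image finj); apply: eq_card => w; rewrite inE.
apply/eqP/fintype.imageP => [ow|[[i u]]]; last first.
  rewrite inE /f /= => Lu ->; have ou := lyn_prim _ Lu.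
  apply/eqP; rewrite eqn_dvd -{1}iter_rot1_order iter_rot1_id eqxx /=.
  rewrite -{1}ou -iter_rot1_order; apply/eqP.
  have : iter (fingraph.order rot1 (iter i rot1 u)) rot1 (iter i rot1 u) = iter i rot1 u.
    by apply/eqP; rewrite iter_rot1_order.
  by rewrite -iterD addnC iterD => /iter_inj.
have [i _ imin] := @arg_minP _ (seq T) 'I_n (Ordinal n_gt0) xpredT
  (fun i => iter i rot1 w : seq T) isT.
set u := iter i rot1 w in imin.
have wE : w = iter ((n - i) %% n) rot1 u.
  rewrite /u -iterD; have := ltn_ord i.
  case: (posnP i) => [-> _|i0 ltin]; first by rewrite subn0 modnn.
  by rewrite modn_small ?subnK ?iter_rot1_id //; lia.
exists (Ordinal (ltn_pmod (n - i) n_gt0), u) => //; rewrite inE /=.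
apply: rot_lyndon => [|s t uE s0 t0]; first by rewrite neq_nil size_tuple.
have su : size s + size t = n by rewrite -size_cat -uE size_tuple.
have tsE : t ++ s = iter (size s) rot1 u.
  by rewrite val_iter_rot1 ?uE ?rot_size_cat // -su leq_addr.
have sn : 0 < size s < n by move: s0 t0; rewrite !neq_nil; lia.
rewrite tsE lt_neqAle; apply/andP; split.
  apply/eqP => /val_inj E; have /eqP/esym := E; rewrite eq_sym.
  rewrite iter_rot1_order => on.
  have : fingraph.order rot1 w %| size s.
    rewrite -iter_rot1_order; apply/eqP; apply: (iter_inj i).
    by rewrite -iterD addnC iterD -/u -E.
  by rewrite ow => /dvdn_leq; lia.
have -> : iter (size s) rot1 u = iter ((size s + i) %% n) rot1 w.
  rewrite /u -iterD {1}(divn_eq (size s + i) n) addnC iterD; congr iter.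
  by apply/eqP; rewrite iter_rot1_order ow dvdn_mull.
exact: (imin (Ordinal (ltn_pmod (size s + i) n_gt0))).
Qed.

(** Sorting the words fixed by the rotation by d according to their period
    gives k ^ d as a sum over the divisors of d; Moebius inversion then counts
    the words of period n. *)
Theorem card_lyndon : #|[pred w : W | lyndon w]| = witt n #|T|.
Proof.
pose h e : int := #|[pred w : W | fingraph.order rot1 w == e]|%:Z.
have hE d : d %| n -> ((#|T| ^ d)%N%:Z = \sum_(e <- divisors d) h e)%R.
  move=> dn; have d0 := dvdn_gt0 n_gt0 dn.
  transitivity (\sum_(w : W) \sum_(e <- divisors d)
                  (fingraph.order rot1 w == e)%:Z)%R.
    rewrite -card_period_tuple // -sum1_card Posz_sum big_mkcond /=.
    apply: eq_bigr => w _; rewrite inE iter_rot1_order.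
    transitivity (count_mem (fingraph.order rot1 w) (divisors d))%:Z.
      rewrite count_uniq_mem ?divisors_uniq // -dvdn_divisors //.
      by case: (_ %| _).
    rewrite -sum1_count Posz_sum big_mkcond /=.
    by apply: eq_bigr => e _; rewrite eq_sym; case: (_ == _).
  rewrite exchange_big; apply: eq_bigr => e _.
  rewrite /h -sum1_card Posz_sum [RHS]big_mkcond /=.
  by apply: eq_bigr => w _; rewrite inE; case: (_ == _).
have := moebius_inversion n_gt0 hE; rewrite /h card_primitive PoszM => E.
by rewrite /witt -E mulKz // -lt0n.
Qed.

End CountLyndon.

End CountingLyndonWords.

(** * Lyndon words over a split alphabet *)

Section ComparingAlphabets.
Local Open Scope order_scope.

Section MapLyndon.
Context {d d' : Order.disp_t} {T : orderType d} {T' : orderType d'}.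
Variables (P : pred T) (phi : T -> T').
Hypothesis phi_mono : {in P &, {mono phi : x y / x < y}}.

Lemma lexi_map u v : all P u -> all P v -> (map phi u < map phi v) = (u < v).
Proof.
elim: u v => [|x u IH] [|y v] //= /andP[Px Pu] /andP[Py Pv].
rewrite !ltxi_cons -(IH v) // !leNgt !phi_mono //.
Qed.

Lemma lyndon_map w : all P w -> lyndon (map phi w) = lyndon w.
Proof.
move=> Pw; rewrite /lyndon size_map; congr (_ && _); first by case: (w).
apply: eq_in_all => i _; rewrite -map_drop lexi_map //.
by apply/allP => x /mem_drop; exact: (allP Pw).
Qed.

End MapLyndon.

Lemma lyndon_nseq_rcons {d : Order.disp_t} {T : orderType d} k (a b : T) :
  a < b -> lyndon (rcons (nseq k a) b).
Proof.
move=> ab; elim: k => [|k IH] //=.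
have Lb : lyndon [:: a] by [].
rewrite -cat1s; apply: lyndon_cat => //.
by case: k IH => [|k] IH /=; [rewrite neqhead_ltxiE ?lt_eqF | rewrite eqhead_ltxiE ltxi0s -size_eq0 size_rcons].
Qed.

Section WordExponent.
Local Open Scope nat_scope.
Variables (t : nat) (alpha : 'I_t -> nat).
Let m := \sum_(i < t) alpha i.

(** The smallest alpha l over the letters l of w: the commutator of w turns
    out to have order p ^ word_exp w in its lower central factor.  The initial
    value m is neutral on nonempty words because it bounds every alpha l. *)
Definition word_exp (w : seq 'I_t) : nat := foldr minn m (map alpha w).

Lemma alpha_le_sum i : alpha i <= m.
Proof. by rewrite /m (bigD1 i) //= leq_addr. Qed.

Lemma word_exp_le l w : l \in w -> word_exp w <= alpha l.
Proof.
elim: w => //= x w IH; rewrite inE /word_exp /= geq_min.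
by case/orP => [/eqP->|/IH]; rewrite ?leqnn // => ->; rewrite orbT.
Qed.

Lemma word_exp_le_sum w : word_exp w <= m.
Proof. by elim: w => //= x w IH; rewrite /word_exp /= geq_min IH orbT. Qed.

Lemma word_exp_mem w : w != [::] -> exists2 l, l \in w & alpha l = word_exp w.
Proof.
elim: w => //= x w IH _; rewrite /word_exp /= -/(word_exp w).
case: (eqVneq w [::]) => [->|w0].
  by exists x; rewrite ?inE //= (minn_idPl _) // alpha_le_sum.
have [l lw lE] := IH w0.
by case: (leqP (alpha x) (word_exp w)) => xw; [exists x|exists l]; rewrite ?inE ?eqxx ?lw ?orbT.
Qed.

(** The alphabet of m letters is cut into consecutive blocks, one block of
    alpha l letters for each l; code j l is the j-th letter of the block of
    l. *)
Let offset (l : 'I_t) := \sum_(i < t | i < l) alpha i.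

Let offset_lt (l l' : 'I_t) : l < l' -> offset l + alpha l <= offset l'.
Proof.
move=> ll'; rewrite /offset [leqRHS](bigD1 l) //= addnC leq_add2l.
rewrite big_mkcond [leqRHS]big_mkcond; apply: leq_sum => i _.
case: ltnP => // il; rewrite (ltn_trans il ll') /=.
by case: eqVneq il => // ->; rewrite ltnn.
Qed.

Let offset_bound l j : j < alpha l -> offset l + j < m.
Proof.
move=> jl; apply: (@leq_trans (offset l + alpha l)); first by rewrite ltn_add2l.
rewrite /offset /m [leqRHS](bigD1 l) //= addnC leq_add2l.
rewrite big_mkcond [leqRHS]big_mkcond; apply: leq_sum => i _.
by case: ltnP => // il; case: eqVneq il => // ->; rewrite ltnn.
Qed.

Let code (j : 'I_m) (l : 'I_t) : 'I_m := insubd j (offset l + j).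

Let val_code (j : 'I_m) l : j < alpha l -> code j l = offset l + j :> nat.
Proof. by move=> jl; rewrite /code val_insubd offset_bound. Qed.

Let code_inj (j j' : 'I_m) l l' : j < alpha l -> j' < alpha l' ->
  code j l = code j' l' -> l = l' /\ j = j'.
Proof.
move=> jl jl' /(congr1 val) /=; rewrite !val_code // => E.
have ll' : l = l'.
  apply: val_inj; case: (ltngtP l l') => // /offset_lt; lia.
by split=> //; apply: val_inj; move: E; rewrite ll' => /addnI.
Qed.

Let code_mono (j : 'I_m) :
  {in [pred l | j < alpha l] &, {mono code j : x y / (x < y)%O}}.
Proof.
move=> x y; rewrite !inE => jx jy; rewrite !ltEord !val_code // ltn_add2r.
case: (ltngtP x y) => [/offset_lt|/offset_lt|/val_inj ->]; lia.
Qed.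

Variable k : nat.
Hypothesis k_gt1 : 1 < k.

(** The pair (w, j) is sent to the j-th copy of w.  It is defined when j is
    smaller than alpha l for all letters l of w, and code j is increasing on
    these letters, so Lyndon words are sent to Lyndon words. *)
Let spread (x : k.-tuple 'I_t * 'I_m) : k.-tuple 'I_m := map_tuple (code x.2) x.1.
Let dom : pred (k.-tuple 'I_t * 'I_m) :=
  [pred x : k.-tuple 'I_t * 'I_m | lyndon x.1 && (x.2 < word_exp x.1)].

Let exp_all (w : k.-tuple 'I_t) (j : 'I_m) : j < word_exp w ->
  all [pred l | j < alpha l] w.
Proof. by move=> jw; apply/allP => l /word_exp_le; exact: leq_trans. Qed.

Let spread_inj : {in dom &, injective spread}.
Proof.
move=> [u j] [v j']; rewrite !inE /= => /andP[Lu ju] /andP[Lv jv] /(congr1 val) /=.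
move: (exp_all ju) (exp_all jv).
case: u Lu {ju} => u /= szu Lu; case: v Lv {jv} => v /= szv Lv; move=> au av E.
suff [uv jj] : u = v /\ j = j' by rewrite -jj; congr (_, _); apply: val_inj.
case: u v szu szv au av E {Lu Lv} => [|x u] [|y v]; rewrite ?eqE /=; try lia.
move=> _ _ /andP[jx au] /andP[jy av] [/code_inj]; rewrite jx jy => /(_ isT isT)[xy jj].
move: av; rewrite -xy -jj => av E; split=> //; congr (_ :: _).
elim: u v au av E => [|a u IH] [|b v] //= /andP[ja au] /andP[jb av] [].
by move=> /code_inj; rewrite ja jb => /(_ isT isT)[<- _] /IH->.
Qed.

Let spread_lyndon : {subset [seq spread x | x in dom] <= [pred w : k.-tuple 'I_m | lyndon w]}.
Proof.
move=> w /fintype.imageP[[u j]]; rewrite !inE /= => /andP[Lu ju] ->.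
by rewrite (lyndon_map (@code_mono j)) ?exp_all.
Qed.

Let card_dom : #|dom| = \sum_(w : k.-tuple 'I_t | lyndon w) word_exp w.
Proof.
rewrite -sum1_card; rewrite (eq_bigl (fun x : k.-tuple 'I_t * 'I_m => lyndon x.1 && (x.2 < word_exp x.1))) //.
rewrite -(pair_big_dep (fun w : k.-tuple 'I_t => lyndon w)
  (fun (w : k.-tuple 'I_t) (j : 'I_m) => j < word_exp w) (fun _ _ => 1)) /=.
apply: eq_bigr => w _.
by rewrite -(big_ord_widen m (fun _ => 1)) ?word_exp_le_sum // sum1_card card_ord.
Qed.

(** The copies of the Lyndon words, counted by the left-hand side, are
    distinct Lyndon words on m letters.  They miss the word a ... a b where a
    and b are the first two letters of the block of i: its letters do not all
    have the same rank in their blocks. *)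
Lemma sum_word_exp_lt (i : 'I_t) : 1 < alpha i ->
  \sum_(w : k.-tuple 'I_t | lyndon w) word_exp w < witt k m.
Proof.
move=> ai; rewrite -[m in witt _ m]card_ord -card_lyndon; last by lia.
rewrite -card_dom.
rewrite -(card_in_image spread_inj).
have m1 : 1 < m := leq_trans ai (alpha_le_sum i).
pose j0 := Ordinal (ltnW m1); pose j1 := Ordinal m1.
have szw : size (rcons (nseq k.-1 (code j0 i)) (code j1 i)) == k.
  by rewrite size_rcons size_nseq prednK // ltnW.
apply: proper_card; apply/properP; split; first exact/fintype.subsetP/spread_lyndon.
exists (Tuple szw); rewrite ?inE /=.
  apply: lyndon_nseq_rcons; rewrite ltEord !val_code //=; last exact: ltnW.
  by rewrite addn0 addn1.
apply/negP => /fintype.imageP[[u j]]; rewrite inE /= => /andP[_ ju'].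
have /= ju := exp_all ju'; move/(congr1 val) => /= E.
have /mapP[a au /code_inj] : code j0 i \in map (code j) u.
  by rewrite -E mem_rcons inE mem_nseq eqxx andbT -subn1 subn_gt0 k_gt1 orbT.
case=> [||_ j0E]; [exact: ltnW | exact: (allP ju) |].
have /mapP[b bu /code_inj] : code j1 i \in map (code j) u.
  by rewrite -E mem_rcons inE eqxx.
case=> [||_ j1E] //; first exact: (allP ju).
by have := congr1 val j0E; rewrite -j1E.
Qed.

End WordExponent.

Lemma sum_word_exp1 t k : (0 < k)%N ->
  (\sum_(w : k.-tuple 'I_t | lyndon w) word_exp (fun=> 1) w = witt k t)%N.
Proof.
move=> k0; rewrite -[t in RHS]card_ord -card_lyndon // -sum1_card.
apply: eq_big => [w|w _]; first by rewrite inE.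
have [|l _ <- //] := @word_exp_mem _ (fun=> 1) w.
by rewrite -size_eq0 size_tuple -lt0n.
Qed.

End ComparingAlphabets.

(** * Subgroups and commutators *)

Section Subgroups.
Local Open Scope classical_set_scope.
Local Open Scope group_scope.

Section GroupIdentities.
Variable G : groupType.
Implicit Types x y z : G.

Lemma comm_mulgl x y z : [~ x * y, z] = [~ x, z] ^ y * [~ y, z].
Proof. by rewrite /commg /conjg !invgM !mulgA; do !rewrite ?mulgK ?mulgVK. Qed.

Lemma comm_mulgr x y z : [~ x, y * z] = [~ x, z] * [~ x, y] ^ z.
Proof. by rewrite /commg /conjg !invgM !mulgA; do !rewrite ?mulgK ?mulgVK. Qed.

Lemma comm_invgl x y : [~ x^-1, y] = ([~ x, y] ^ x^-1)^-1.
Proof. by rewrite /commg /conjg !invgM !invgK !mulgA; do !rewrite ?mulgK ?mulgVK. Qed.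

Lemma conjg_mulR x y : x ^ y = x * [~ x, y].
Proof. by rewrite /commg mulVKg. Qed.

Lemma Hall_Witt x y z :
  [~ x, y^-1, z] ^ y * [~ y, z^-1, x] ^ z * [~ z, x^-1, y] ^ x = 1.
Proof.
rewrite /commg /conjg !invgM !invgK !mulgA.
by do !rewrite ?mulgK ?mulgVK ?mulgV ?mulVg ?mul1g ?mulg1.
Qed.

End GroupIdentities.

Section Generated.
Variable G : groupType.
Implicit Types A B N : set G.

Lemma sub_generated A : A `<=` generated_subgroup A.
Proof. by move=> x Ax B [_]; apply. Qed.

Lemma generated_min A B : is_subgroup B -> A `<=` B -> generated_subgroup A `<=` B.
Proof. by move=> sB AB x; apply. Qed.

Lemma generatedS A B : A `<=` B -> generated_subgroup A `<=` generated_subgroup B.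
Proof.
move=> AB; apply: generated_min; first exact: is_subgroup_generated.
exact: subset_trans AB (@sub_generated B).
Qed.

Lemma mem_commutator A B x y : A x -> B y -> commutator_subgroup A B [~ x, y].
Proof. by move=> Ax By; apply: sub_generated; exists x => //; exists y. Qed.

Lemma commutator_min A B N : is_subgroup N ->
  (forall x y, A x -> B y -> N [~ x, y]) -> commutator_subgroup A B `<=` N.
Proof. by move=> sN H; apply: generated_min => // z [x Ax [y By ->]]; exact: H. Qed.

Lemma normal_conj N x y : is_normal N -> N (x ^ y) -> N x.
Proof. by move=> [_ NJ] /NJ - /(_ y^-1); rewrite conjgK. Qed.

Lemma subgroup_commC N x y : is_subgroup N -> N [~ x, y] -> N [~ y, x].
Proof. by move=> [_ _ NV] /NV; rewrite invgR. Qed.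

Lemma normal_comml N x y : is_normal N -> N x -> N [~ x, y].
Proof. by move=> [[_ NM NV] NJ] Nx; rewrite commgEl; apply: NM; auto. Qed.

Lemma subgroupX B x n : is_subgroup B -> B x -> B (x ^+ n).
Proof. by move=> [B1 BM _] Bx; elim: n => // n IH; rewrite expgS; apply: BM. Qed.

Lemma subgroup_prod B (I : Type) (r : seq I) (P : pred I) (E : I -> G) :
  is_subgroup B -> (forall i, P i -> B (E i)) -> B (\prod_(i <- r | P i) E i).
Proof. by move=> [B1 BM _] H; apply: (big_ind B). Qed.

(** By the Hall-Witt identity, a normal subgroup containing two of the three
    double commutators contains the third one. *)
Lemma three_subgroup N x y z : is_normal N ->
  N [~ x, y^-1, z] -> N [~ z, x^-1, y] -> N [~ y, z^-1, x].
Proof.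
move=> nN; have [[N1 NM NV] NJ] := nN => N1' N2'.
apply: (@normal_conj _ _ z nN).
have := Hall_Witt x y z; move/(congr1 (fun g => ([~ x, y^-1, z] ^ y)^-1 * g)).
rewrite mulg1 -mulgA mulKg => /(congr1 (fun g => g * ([~ z, x^-1, y] ^ x)^-1)).
by rewrite mulgK => ->; apply: NM; apply: NV; apply: NJ.
Qed.

Lemma iter_commutator_sub N k : is_normal N -> iter_commutator k N `<=` N.
Proof.
move=> nN; elim: k => //= k IH; apply: commutator_min; first by case: nN.
by move=> x y /IH Nx _; apply: normal_comml.
Qed.

Lemma iter_commutatorS k N N' : N `<=` N' -> iter_commutator k N `<=` iter_commutator k N'.
Proof.
move=> NN'; elim: k => //= k IH; apply: commutator_min; first exact: is_subgroup_generated.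
by move=> x y /IH; exact: mem_commutator.
Qed.

(** By induction on j: an element of the next term is a product of
    commutators [a, b], and the three subgroup lemma moves x past a and b one
    after the other. *)
Lemma iter_commutator_comm N i j x y : is_normal N ->
  iter_commutator i N x -> iter_commutator j setT y ->
  iter_commutator (i + j).+1 N [~ x, y].
Proof.
move=> nN; elim: j i x y => [|j IH] i x y Nx.
  by move=> _; rewrite addn0; exact: mem_commutator.
have nM : is_normal (iter_commutator (i + j.+1).+1 N) by exact: is_normal_iter_commutator.
have sM := nM.1; have [M1 MM MV] := sM; have MJ := nM.2.
move: y; apply: commutator_min.
  split=> [|a b Ma Mb|a Ma]; first by rewrite commg1.
    by rewrite comm_mulgr; apply: MM => //; apply: MJ.
  apply: (subgroup_commC sM); rewrite comm_invgl; apply: MV; apply: MJ.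
  exact: (subgroup_commC sM).
have nT := is_normal_setT G.
move=> a b Ca _; apply: (subgroup_commC sM); rewrite -(invgK b); apply: (three_subgroup nM).
  have Ca' : iter_commutator j setT a^-1.
    by have [[_ _ V] _] := is_normal_iter_commutator j nT; exact: V.
  by rewrite addnS; apply: mem_commutator => //; exact: IH.
have [[_ _ NV'] _] := is_normal_iter_commutator i nN.
rewrite addnS -addSn; apply: IH => //.
apply: (subgroup_commC (is_normal_iter_commutator i.+1 nN).1).
apply: mem_commutator => //; exact: NV'.
Qed.

End Generated.

End Subgroups.

(** * Lyndon commutators span the lower central factors *)

Section LowerCentralFactors.
Local Open Scope classical_set_scope.
Local Open Scope group_scope.

Section LowerCentral.
Variable F : groupType.
Local Notation gamma := (lower_central F).
Implicit Types a b c x y z : F.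

Lemma gamma_comm i j x y : gamma i x -> gamma j y -> gamma (i + j)%N [~ x, y].
Proof.
have nT := is_normal_setT F.
case: i j => [|i] [|j] //; rewrite /lower_central /=.
- move=> _ gy; apply: (subgroup_commC (is_normal_iter_commutator j nT).1).
  exact: (normal_comml _ (is_normal_iter_commutator j nT)).
- by rewrite addn0 => gx _; exact: (normal_comml _ (is_normal_iter_commutator i nT)).
- by rewrite addnS; exact: iter_commutator_comm.
Qed.

Lemma gamma_leq i j : (i <= j)%N -> gamma j `<=` gamma i.
Proof.
move/subnK <-; elim: (j - i)%N => // k IH; apply: subset_trans IH.
rewrite addSn; case: (k + i)%N => // l x; rewrite /lower_central /=.
have nT := is_normal_iter_commutator l (is_normal_setT F).
by apply: (commutator_min nT.1) => a b ga _; apply: (normal_comml _ nT).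
Qed.

Lemma gamma_group k : is_subgroup (gamma k).
Proof. exact: (is_normal_lower_central F k).1. Qed.

Lemma gamma_conj k x y : gamma k x -> gamma k (x ^ y).
Proof. exact: (is_normal_lower_central F k).2. Qed.

(** The factors of the lower central series form a graded Lie ring.  Its laws
    are expressed here as membership in a subgroup B containing the term
    s.+1: modulo that term, commutators of total weight s are central and
    additive in each argument, and satisfy the Jacobi identity. *)
Section GradedCommutators.
Variables (B : set F) (s : nat).
Hypotheses (sB : is_subgroup B) (gB : gamma s.+1 `<=` B).

Lemma graded_conj x g : gamma s x -> B x -> B (x ^ g).
Proof.
have [_ BM _] := sB; move=> gx Bx; rewrite conjg_mulR; apply: BM => //.
by apply: gB; rewrite -addn1; exact: gamma_comm.
Qed.

Section Two.
Variables (i j : nat).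
Hypothesis sE : (i + j)%N = s.

Lemma graded_commMl a a' b : gamma i a -> gamma j b ->
  B [~ a, b] -> B [~ a', b] -> B [~ a * a', b].
Proof.
have [_ BM _] := sB; move=> ga gb Ba Ba'; rewrite comm_mulgl; apply: BM => //.
by apply: graded_conj => //; rewrite -sE; exact: gamma_comm.
Qed.

Lemma graded_commVl a b : gamma i a -> gamma j b -> B [~ a, b] -> B [~ a^-1, b].
Proof.
have [_ _ BV] := sB; move=> ga gb Ba; rewrite comm_invgl; apply: BV.
by apply: graded_conj => //; rewrite -sE; exact: gamma_comm.
Qed.

Lemma graded_comm_generated (X : set F) z b : X `<=` gamma i -> gamma j b ->
  (forall x, X x -> B [~ x, b]) -> generated_subgroup X z -> B [~ z, b].
Proof.
move=> Xg gb XB Xz.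
suff [] : (gamma i `&` [set x | B [~ x, b]]) z by [].
apply: Xz; split; last by move=> x Xx; split; [exact: Xg|exact: XB].
have [G1 GM GV] := gamma_group i; have [B1 _ _] := sB.
split=> [|x y [gx Bx] [gy By]|x [gx Bx]]; split=> //=.
- by rewrite comm1g.
- exact: GM.
- exact: graded_commMl.
- exact: GV.
- exact: graded_commVl.
Qed.

Lemma graded_commJl a b g : gamma i a -> gamma j b -> B [~ a, b] -> B [~ a ^ g, b].
Proof.
move=> ga gb Bab; rewrite conjg_mulR; apply: graded_commMl => //; apply: gB.
rewrite -sE -addSn; apply: gamma_comm => //.
by rewrite -addn1; exact: gamma_comm.
Qed.

End Two.

Lemma graded_commVr i j a b : (i + j)%N = s -> gamma i a -> gamma j b ->
  B [~ a, b] -> B [~ a, b^-1].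
Proof.
move=> sE ga gb /(subgroup_commC sB) Bba; apply: (subgroup_commC sB).
by apply: (@graded_commVl j i) => //; rewrite addnC.
Qed.

(** The Hall-Witt identity, whose inverses and conjugations only matter in
    weight s.+1. *)
Lemma graded_jacobi i j l a b c : (i + j + l)%N = s ->
  gamma i a -> gamma j b -> gamma l c ->
  B [~ [~ a, c], b] -> B [~ a, [~ b, c]] -> B [~ [~ a, b], c].
Proof.
move=> sE ga gb gc Bacb Babc.
have [_ BM BV] := sB.
have gV k x : gamma k x -> gamma k x^-1 by have [_ _] := gamma_group k; apply.
have := Hall_Witt a b^-1 c; rewrite invgK.
have E1 : B ([~ b^-1, c^-1, a] ^ c).
  have -> : [~ b^-1, c^-1] = [~ b, c] ^ (b^-1 * c^-1).
    by rewrite /commg /conjg ?invgM ?invgK ?mulgA; do !rewrite ?mulgK ?mulgVK ?mulgV ?mulVg ?mul1g.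
  have sE' : (j + l + i)%N = s by rewrite -sE; lia.
  apply: graded_conj.
    by rewrite -sE'; apply: gamma_comm => //; apply: gamma_conj; exact: gamma_comm.
  apply: (graded_commJl sE') => //; first exact: gamma_comm.
  exact: (subgroup_commC sB).
have E2 : B ([~ c, a^-1, b^-1] ^ a).
  have -> : [~ c, a^-1] = [~ a, c] ^ a^-1.
    by rewrite /commg /conjg ?invgM ?invgK ?mulgA; do !rewrite ?mulgK ?mulgVK ?mulgV ?mulVg ?mul1g.
  have sE' : (i + l + j)%N = s by rewrite -sE; lia.
  have gac : gamma (i + l)%N [~ a, c] by exact: gamma_comm.
  apply: graded_conj.
    by rewrite -sE'; apply: gamma_comm; [exact: gamma_conj | exact: gV].
  apply: (graded_commJl sE') => //; first exact: gV.
  exact: (graded_commVr sE').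
move=> E; have : B ([~ a, b, c] ^ b^-1).
  have -> : [~ a, b, c] ^ b^-1 =
    ([~ c, a^-1, b^-1] ^ a)^-1 * ([~ b^-1, c^-1, a] ^ c)^-1.
    by apply/eqP; rewrite -invgM -mulg_eq1 mulgA; apply/eqP.
  by apply: BM; exact: BV.
move/(graded_conj b); rewrite -conjgM mulVg conjg1; apply.
by apply: gamma_conj; rewrite -sE; apply: gamma_comm => //; exact: gamma_comm.
Qed.

End GradedCommutators.

End LowerCentral.

(** Lam is a family of relations: the factor of weight k under study is
    that of gamma k by Lam k.  By Lam_comm, these relations form an ideal of
    the graded Lie ring. *)
Section Spanning.
Context {d : Order.disp_t} {T : finOrderType d}.
Variables (F : groupType) (y : T -> F) (Lam : nat -> set F).
Local Notation gamma := (lower_central F).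
Hypothesis gamma_Lam : forall k, gamma k.+1 `<=` Lam k.
Hypothesis Lam_gamma : forall k, Lam k `<=` gamma k.
Hypothesis Lam_comm : forall i j x z, (0 < i)%N -> (0 < j)%N ->
  Lam i x -> gamma j z -> Lam (i + j)%N [~ x, z].

Definition lyndon_comm : seq T -> F := bracket (fun a b : F => [~ a, b]) y 1.

Lemma lyndon_comm_gamma w : lyndon w -> gamma (size w) (lyndon_comm w).
Proof.
elim/(@lyndon_ind _ T): w / => // w Lw w1 _ _ IHl IHr.
rewrite /lyndon_comm bracketE // -{1}(std_cat w1) size_cat; exact: gamma_comm.
Qed.

(** The subgroup spanned modulo Lam k by the Lyndon commutators of weight k
    whose word satisfies P. *)
Definition lyndon_span k (P : pred (seq T)) : set F :=
  generated_subgroup (Lam k `|` [set lyndon_comm w | w in [set w | [/\ lyndon w, size w = k & P w]]]).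

Lemma lyndon_span_group k P : is_subgroup (lyndon_span k P).
Proof. exact: is_subgroup_generated. Qed.

Lemma lyndon_span_Lam k P : Lam k `<=` lyndon_span k P.
Proof. by move=> x Lx; apply: sub_generated; left. Qed.

Lemma lyndon_span_gamma k P : gamma k.+1 `<=` lyndon_span k P.
Proof. exact: subset_trans (@gamma_Lam k) (@lyndon_span_Lam k P). Qed.

Lemma lyndon_span_lcomm (P : pred (seq T)) w :
  lyndon w -> P w -> lyndon_span (size w) P (lyndon_comm w).
Proof. by move=> Lw Pw; apply: sub_generated; right; exists w. Qed.

Lemma lyndon_spanS k (P Q : pred (seq T)) :
  (forall w, P w -> Q w) -> lyndon_span k P `<=` lyndon_span k Q.
Proof.
move=> PQ; apply: generatedS => x [Lx|[w [Lw sw Pw] <-]]; first by left.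
by right; exists w => //; split => //; exact: PQ.
Qed.

Lemma lyndon_span_comm (B : set F) i j (P : pred (seq T)) z c :
  (0 < i)%N -> (0 < j)%N ->
  is_subgroup B -> Lam (i + j) `<=` B -> gamma j c ->
  (forall w, lyndon w -> size w = i -> P w -> B [~ lyndon_comm w, c]) ->
  lyndon_span i P z -> B [~ z, c].
Proof.
move=> i0 j0 sB LB gc H; have gB : gamma (i + j).+1 `<=` B := subset_trans (@gamma_Lam _) LB.
apply: (graded_comm_generated sB gB (erefl (i + j)%N)) => //.
  by move=> x [/Lam_gamma //|[w [Lw <- _] <-]]; exact: lyndon_comm_gamma.
by move=> x [Lx|[w [Lw sw Pw] <-]]; [exact/LB/Lam_comm | exact: H].
Qed.

(** Words of bounded length over T are finite in number; the position of v
    among them is the measure for an induction along the lexicographic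
    order. *)
Let rank N (v : seq T) := #|[pred z : N.-bseq T | (val z < v)%O]|.

Let rank_lt N (u v : seq T) : (size u <= N)%N -> (u < v)%O -> (rank N u < rank N v)%N.
Proof.
move=> su uv; apply: proper_card; apply/properP; split.
  by apply/fintype.subsetP => z; rewrite !inE => /lt_trans; apply.
by exists (Bseq su); rewrite !inE ?ltxx.
Qed.

(** Straightening.  If (u, v) is the standard factorization of u ++ v, the
    bracket is the Lyndon commutator of u ++ v, and u ++ v < v.  Otherwise u
    splits as l ++ q with q < v, and the Jacobi identity rewrites
    [[l, q], v] through [[l, v], q] and [l, [q, v]].  The inner brackets have
    smaller weight, so they are spanned by commutators of words w < v; the
    outer brackets then involve two words below v, with the same total
    weight. *)
Lemma lyndon_comm_bracket u v : lyndon u -> lyndon v -> (u < v)%O ->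
  lyndon_span (size u + size v) (fun w => (w < v)%O) [~ lyndon_comm u, lyndon_comm v].
Proof.
have [N] := ubnP (size u + size v); elim: N u v => // N IHN u v.
have [r] := ubnP (rank (size u + size v) v); elim: r u v => // r IHr u v rk sN Lu Lv uv.
set n := (size u + size v)%N; pose lt_v : pred (seq T) := fun w => (w < v)%O.
have size_gt0 (w : seq T) : lyndon w -> (0 < size w)%N by move/lyndon_neq0; rewrite neq_nil.
have u0 := size_gt0 _ Lu; have v0 := size_gt0 _ Lv.
have sB : is_subgroup (lyndon_span n lt_v) := lyndon_span_group _ _.
have gB : gamma n.+1 `<=` lyndon_span n lt_v := @lyndon_span_gamma n lt_v.
(* both words are below v: the larger one takes the place of v *)
have IH (w z : seq T) : lyndon w -> lyndon z -> (size w + size z)%N = n ->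
    (w < v)%O -> (z < v)%O -> lyndon_span n lt_v [~ lyndon_comm w, lyndon_comm z].
  move=> Lw Lz wzn wv zv; wlog wz : w z Lw Lz wzn wv zv / (w < z)%O.
    move=> H; case: (ltgtP w z) => [wz|zw|->]; first exact: H.
      by apply: (subgroup_commC sB); apply: H => //; rewrite addnC.
    by rewrite commgg; case: sB.
  have zn : (size z <= n)%N by rewrite -wzn leq_addl.
  have := IHr w z; rewrite wzn => h.
  have {}h := h (leq_trans (rank_lt zn zv) rk) sN Lw Lz wz.
  by apply: lyndon_spanS h => x xz; exact: lt_trans xz zv.
have [uv_std|] := boolP ((size u <= 1)%N || (v <= std_right u)%O).
  have [lE rE] := std_cat_eq Lu Lv uv_std.
  have uv1 : (1 < size (u ++ v))%N by rewrite size_cat; exact: leq_add u0 v0.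
  have := @lyndon_span_lcomm lt_v _ (lyndon_cat Lu Lv uv).
  rewrite size_cat /lyndon_comm bracketE // lE rE; apply.
  by apply: lyndon_suffix (lyndon_cat Lu Lv uv) _ _; rewrite neq_nil.
rewrite negb_or -ltnNge -ltNge => /andP[u1 rv].
have Ll := lyndon_std_left u1 Lu; have Lr := lyndon_std_right u1.
set l := std_left u in Ll; set q := std_right u in rv Lr.
have lq : (l < q)%O := std_lt u1 Lu.
have szu : (size l + size q)%N = size u by rewrite -size_cat std_cat.
have l0 := size_gt0 _ Ll; have q0 := size_gt0 _ Lr.
have -> : lyndon_comm u = [~ lyndon_comm l, lyndon_comm q] by rewrite /lyndon_comm bracketE.
have lv : (l < v)%O := lt_trans lq rv.
have nE : (size l + size q + size v)%N = n by rewrite szu.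
have lv_n : (size l + size v < n)%N.
  by rewrite -nE addnAC -[X in (X < _)%N]addn0 ltn_add2l.
have qv_n : (size q + size v < n)%N.
  by rewrite -nE -addnA -[X in (X < _)%N]add0n ltn_add2r.
(* [[l, q], v] = [[l, v], q] + [l, [q, v]] *)
apply: (graded_jacobi sB gB nE); try exact: lyndon_comm_gamma.
  have E : (size l + size v + size q)%N = n by rewrite -nE; lia.
  apply: (@lyndon_span_comm _ (size l + size v)%N (size q) lt_v) => //.
  - by rewrite addn_gt0 l0.
  - by rewrite E; exact: lyndon_span_Lam.
  - exact: lyndon_comm_gamma.
  - by move=> w Lw sw wv; apply: IH => //; rewrite sw.
  by apply: IHN => //; apply: leq_trans lv_n sN.
have E : (size q + size v + size l)%N = n by rewrite -nE; lia.
apply: (subgroup_commC sB).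
apply: (@lyndon_span_comm _ (size q + size v)%N (size l) lt_v) => //.
- by rewrite addn_gt0 q0.
- by rewrite E; exact: lyndon_span_Lam.
- exact: lyndon_comm_gamma.
- by move=> w Lw sw wv; apply: IH => //; rewrite sw.
by apply: IHN => //; apply: leq_trans qv_n sN.
Qed.

Hypothesis gen_y : [set: F] `<=` generated_subgroup (Lam 1 `|` range y).

(** If the y l generate modulo Lam 1, the weight k factor is generated by
    iterated brackets of the y l, which straightening reduces to Lyndon
    commutators. *)
Lemma gamma_lyndon_span k : (0 < k)%N -> gamma k `<=` lyndon_span k predT.
Proof.
have F1 : [set: F] `<=` lyndon_span 1 predT.
  apply: subset_trans gen_y _; apply: generatedS => x [Lx|[l _ <-]]; first by left.
  by right; exists [:: l].
have allT (u v : seq T) : lyndon u -> lyndon v ->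
    lyndon_span (size u + size v) predT [~ lyndon_comm u, lyndon_comm v].
  move=> Lu Lv; case: (ltgtP u v) => [uv|vu|->].
  - by apply: lyndon_spanS (lyndon_comm_bracket Lu Lv uv).
  - rewrite addnC; apply: (subgroup_commC (lyndon_span_group _ _)).
    by apply: lyndon_spanS (lyndon_comm_bracket Lv Lu vu).
  - by rewrite commgg; case: (lyndon_span_group (size v + size v) predT).
elim: k => // -[|k] IH _; first exact: F1.
set n := k.+2; have sB : is_subgroup (lyndon_span n predT) := lyndon_span_group _ _.
have nE : (k.+1 + 1)%N = n by rewrite addn1.
apply: (commutator_min sB) => a g /(IH isT) ka _.
apply: (@lyndon_span_comm _ k.+1 1 predT) ka => //.
  by rewrite nE; exact: lyndon_span_Lam.
move=> w Lw sw _; apply: (subgroup_commC sB).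
apply: (@lyndon_span_comm _ 1 k.+1 predT) (F1 g I) => //.
- by rewrite addnC nE; exact: lyndon_span_Lam.
- by rewrite -sw; exact: lyndon_comm_gamma.
move=> w' Lw' sw' _; have := allT _ _ Lw' Lw; by rewrite sw sw' addnC nE.
Qed.

End Spanning.

End LowerCentralFactors.

(** * Collection modulo relations *)

Section Collection.
Local Open Scope classical_set_scope.
Local Open Scope group_scope.

Lemma prod_expgD (G : groupType) (I : Type) (r : seq I) (X : I -> G) (a b : I -> nat) :
  (forall i j, commute (X i) (X j)) ->
  \prod_(i <- r) X i ^+ a i * \prod_(i <- r) X i ^+ b i =
  \prod_(i <- r) X i ^+ (a i + b i).
Proof.
move=> comX; elim: r => [|i r IH]; first by rewrite !big_nil mulg1.
rewrite !big_cons -IH expgnDr -!mulgA; congr (_ * _); rewrite !mulgA; congr (_ * _).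
apply/esym; apply: (big_ind (commute (X i ^+ b i))).
- exact: commute1.
- by move=> *; exact: commuteM.
by move=> j _; apply/commuteX2.
Qed.

Section MultiplicativeMaps.
Variables (G H : groupType) (f : {multiplicative G -> H}).

Lemma hom1 : f 1 = 1.
Proof. by apply: (@mulgI _ (f 1)); rewrite -gmulfM !mulg1. Qed.

Lemma homV x : f x^-1 = (f x)^-1.
Proof. by apply: (@mulgI _ (f x)); rewrite -gmulfM !mulgV hom1. Qed.

Lemma homX n x : f (x ^+ n) = f x ^+ n.
Proof. by elim: n => [|n IH]; rewrite ?hom1 // !expgS gmulfM IH. Qed.

Lemma homR x y : f [~ x, y] = [~ f x, f y].
Proof. by rewrite /commg /conjg !gmulfM !homV. Qed.

Lemma hom_prod (I : Type) (r : seq I) (P : pred I) (E : I -> G) :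
  f (\prod_(i <- r | P i) E i) = \prod_(i <- r | P i) f (E i).
Proof. exact: (big_morph f (@gmulfM _ _ f) hom1). Qed.

Lemma preimage_subgroup (N : set H) : is_subgroup N -> is_subgroup (f @^-1` N).
Proof.
move=> [N1 NM NV]; rewrite /preimage; split=> [|a b|a] /=; rewrite ?hom1 ?gmulfM ?homV //.
- exact: NM.
- exact: NV.
Qed.

Lemma hom_gamma k x : lower_central G k x -> lower_central H k (f x).
Proof.
rewrite /lower_central; elim: k.-1 x => // l IH /=.
apply: (commutator_min (preimage_subgroup (is_subgroup_generated _))).
by move=> a b /IH fa _; rewrite /preimage /= homR; apply: mem_commutator.
Qed.

End MultiplicativeMaps.

Section QuotientMap.
Variables (G : groupType) (N : normalSubgroup G).
Implicit Types x y : G.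

Lemma quot_map_eq1 x : quot_map N x = 1 <-> normal_set N x.
Proof.
have [_ _ NV] := (normal_setP N).1.
rewrite (_ : 1 = quot_map N 1) // quot_mapP mulg1; split=> [/NV|]; rewrite ?invgK //.
exact: NV.
Qed.

Lemma quot_map_commute x y : normal_set N [~ x, y] -> commute (quot_map N x) (quot_map N y).
Proof. by move=> Nxy; apply/commgP/eqP; rewrite -homR; apply/quot_map_eq1. Qed.

End QuotientMap.

Section Powers.
Variable F : groupType.
Local Notation gamma := (lower_central F).

(** Raising to a power commutes with bracketing in the graded Lie ring. *)
Lemma gamma_commX i j a b n : gamma i a -> gamma j b ->
  gamma (i + j).+1 ([~ a, b] ^- n * [~ a ^+ n, b]).
Proof.
move=> ga gb; have [G1 GM GV] := gamma_group F (i + j).+1.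
elim: n => [|n IH]; first by rewrite comm1g invg1 mulg1.
rewrite expgS (expgS a) comm_mulgl (conjg_mulR [~ a, b]) invgM.
have E (x z e r : F) : r^-1 * x^-1 * (x * z * e) = z ^ r * (r^-1 * e).
  by rewrite conjgE !mulgA; do !rewrite ?mulgK ?mulgVK.
rewrite {}E.
apply: GM => //; apply: gamma_conj; rewrite -addn1.
by apply: gamma_comm => //; exact: gamma_comm.
Qed.

End Powers.

Section NormalForm.
Context {d : Order.disp_t} {T : finOrderType d}.
Variables (F : groupType) (y : T -> F) (Lam : nat -> set F).
Local Notation gamma := (lower_central F).
Hypothesis Lam_normal : forall k, is_normal (Lam k).
Hypothesis gamma_Lam : forall k, gamma k.+1 `<=` Lam k.
Hypothesis Lam_gamma : forall k, Lam k `<=` gamma k.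
Hypothesis Lam_comm : forall i j x z, (0 < i)%N -> (0 < j)%N ->
  Lam i x -> gamma j z -> Lam (i + j)%N [~ x, z].

(** The commutator is additive in each letter, so a relation on one letter
    of w passes to the whole commutator. *)
Lemma lyndon_comm_exp w l q : lyndon w -> l \in w -> Lam 1 (y l ^+ q) ->
  Lam (size w) (lyndon_comm y w ^+ q).
Proof.
move=> Lw + Ly; elim/(@lyndon_ind _ T): w / Lw => [x|w Lw w1 Ll Lr IHl IHr].
  by rewrite inE => /eqP <-.
rewrite -{1}(std_cat w1) mem_cat.
set u := std_left w in Ll IHl *; set v := std_right w in Lr IHr *.
have -> : lyndon_comm y w = [~ lyndon_comm y u, lyndon_comm y v] by rewrite /lyndon_comm bracketE.
have sE : (size u + size v)%N = size w by rewrite -size_cat std_cat.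
have [s1 sM sV] := (Lam_normal (size w)).1.
have gl : forall w, lyndon w -> gamma (size w) (lyndon_comm y w) by exact: lyndon_comm_gamma.
have u0 : (0 < size u)%N by rewrite -neq_nil lyndon_neq0.
have v0 : (0 < size v)%N by rewrite -neq_nil lyndon_neq0.
have lyndon_commX a b i j : (i + j)%N = size w -> gamma i a -> gamma j b ->
    Lam (size w) [~ a ^+ q, b] -> Lam (size w) ([~ a, b] ^+ q).
  move=> ij ga gb Lab; have := gamma_Lam (gamma_commX q ga gb).
  by rewrite ij => /sV/(sM _ _ Lab); rewrite invgM invgK mulVKg.
case/orP=> [/IHl Lu|/IHr Lv].
  by apply: (lyndon_commX _ _ _ _ sE); [exact: gl | exact: gl | rewrite -sE; apply: Lam_comm => //; exact: gl].
rewrite -[_ ^+ q]invgK -expVgn invgR; apply: sV.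
rewrite addnC in sE; apply: (lyndon_commX _ _ _ _ sE); [exact: gl | exact: gl |].
by rewrite -sE; apply: Lam_comm => //; exact: gl.
Qed.

Hypothesis gen_y : [set: F] `<=` generated_subgroup (Lam 1 `|` range y).
Variables (k : nat) (q : seq T -> nat).
Hypothesis k_gt0 : (0 < k)%N.
Hypothesis q_gt0 : forall w, (0 < q w)%N.
Hypothesis q_exp : forall w, lyndon w -> Lam (size w) (lyndon_comm y w ^+ q w).

Definition lyndon_word : finType := {w : k.-tuple T | lyndon w}.

Definition lyndon_prod (a : lyndon_word -> nat) : F :=
  \prod_(w : lyndon_word) lyndon_comm y (val (val w)) ^+ a w.

Lemma lyndon_prod_gamma a : gamma k (lyndon_prod a).
Proof.
apply: subgroup_prod => [|[w Lw] _ /=]; first exact: gamma_group.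
by apply: subgroupX; rewrite -?[k in lower_central _ k](size_tuple w);
  [exact: gamma_group | exact: lyndon_comm_gamma].
Qed.

(** In the abelian factor of weight k, every element is a product of Lyndon
    commutators in a fixed order; the exponents are reduced modulo the known
    relations. *)
Lemma collection z : gamma k z ->
  exists a : {dffun forall w : lyndon_word, 'I_(q (val (val w)))},
    Lam k ((lyndon_prod (fun w => a w))^-1 * z).
Proof.
move=> gz; pose N := NormalSubgroup (Lam_normal k).
pose X (w : lyndon_word) := quot_map N (lyndon_comm y (val (val w))).
have glw (w : lyndon_word) : gamma k (lyndon_comm y (val (val w))).
  by case: w => w Lw /=; rewrite -[k in gamma k](size_tuple w); exact: lyndon_comm_gamma.
have comX v w : commute (X v) (X w).
  apply: quot_map_commute; apply: gamma_Lam; apply: (@gamma_leq _ _ (k + k)).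
    by rewrite -addn1 leq_add2l.
  exact: gamma_comm.
have Xq w : X w ^+ q (val (val w)) = 1.
  rewrite -homX; apply/quot_map_eq1; case: w => w Lw /=.
  by have := q_exp Lw; rewrite size_tuple.
have XE (a : lyndon_word -> nat) : quot_map N (lyndon_prod a) = \prod_w X w ^+ a w.
  by rewrite /lyndon_prod hom_prod; apply: eq_bigr => w _; rewrite homX.
suff [a za] : exists a : lyndon_word -> nat, quot_map N z = \prod_w X w ^+ a w.
  exists [ffun w => Ordinal (ltn_pmod (a w) (q_gt0 (val (val w))))].
  apply/(quot_mapP N); rewrite XE za; apply: eq_bigr => w _; rewrite ffunE /=.
  by rewrite [in RHS](divn_eq (a w) (q (val (val w)))) expgnDr mulnC expgnA Xq expg1n mul1g.
have sS : is_subgroup [set z | exists a : lyndon_word -> nat, quot_map N z = \prod_w X w ^+ a w].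
  split=> [|z1 z2 [a1 E1] [a2 E2]|z1 [a1 E1]] /=.
  - by exists (fun=> 0%N); rewrite hom1 big1.
  - by exists (fun w => a1 w + a2 w)%N; rewrite gmulfM /= E1 E2 prod_expgD.
  exists (fun w => (q (val (val w))).-1 * a1 w)%N; rewrite homV /= E1.
  apply: mulg1_eq; rewrite prod_expgD // big1 // => w _.
  by rewrite -mulSn prednK // expgnA Xq expg1n.
have := gamma_lyndon_span gamma_Lam Lam_gamma Lam_comm gen_y k_gt0 gz.
apply: (generated_min sS).
move=> {z gz} z [Lz|[w [Lw sw _] <-]].
  by exists (fun=> 0%N); rewrite big1 //; apply/quot_map_eq1.
have szw : size w == k by apply/eqP.
pose w' : lyndon_word := exist (fun w : k.-tuple T => lyndon w) (Tuple szw) Lw.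
exists (fun v => (v == w') : nat).
transitivity (\prod_(v | v == w') X v); first by rewrite big_pred1_eq.
by rewrite big_mkcond; apply: eq_bigr => v _; rewrite expgb.
Qed.

End NormalForm.

End Collection.

(** * Power series in noncommuting variables *)

Section PowerSeries.
Local Open Scope classical_set_scope.
Local Open Scope ring_scope.

Section Series.
Variables (T : eqType) (R : nzRingType).

(** Power series in noncommuting variables indexed by T: the value at a word
    is the coefficient of the corresponding monomial. *)
Definition series : Type := seq T -> R.

HB.instance Definition _ := gen_eqMixin series.
HB.instance Definition _ := gen_choiceMixin series.

Implicit Types (f g h : series) (u v w : seq T) (x : T).

Definition series_add f g : series := fun w => f w + g w.
Definition series_opp f : series := fun w => - f w.
Definition series_zero : series := fun _ => 0.

Fact series_addA : associative series_add.
Proof. by move=> f g h; apply/funext => w; rewrite /series_add addrA. Qed.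
Fact series_addC : commutative series_add.
Proof. by move=> f g; apply/funext => w; rewrite /series_add addrC. Qed.
Fact series_add0 : left_id series_zero series_add.
Proof. by move=> f; apply/funext => w; rewrite /series_add add0r. Qed.
Fact series_addN : left_inverse series_zero series_opp series_add.
Proof. by move=> f; apply/funext => w; rewrite /series_add addNr. Qed.

HB.instance Definition _ := GRing.isZmodule.Build series
  series_addA series_addC series_add0 series_addN.

Lemma seriesD f g w : (f + g) w = f w + g w. Proof. by []. Qed.
Lemma seriesN f w : (- f) w = - f w. Proof. by []. Qed.
Lemma series0 w : (0 : series) w = 0. Proof. by []. Qed.
Lemma seriesMn f n w : (f *+ n) w = f w *+ n.
Proof. by elim: n => [|n IH]; rewrite ?mulr0n // !mulrS seriesD IH. Qed.
Lemma series_sum (I : Type) (r : seq I) (P : pred I) (E : I -> series) w :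
  (\sum_(i <- r | P i) E i) w = \sum_(i <- r | P i) E i w.
Proof. exact: (big_morph (fun f : series => f w) (fun f g => seriesD f g w) (series0 w)). Qed.

Definition shift x f : series := fun w => f (x :: w).

(** The convolution over all factorizations of w, computed by peeling off the
    first letter of w: this form turns the ring axioms into inductions on w
    without any reindexing of sums. *)
Fixpoint series_mul_rec f g w {struct w} : R :=
  if w is x :: w' then f [::] * g w + series_mul_rec (shift x f) g w'
  else f [::] * g [::].
Definition series_mul f g : series := series_mul_rec f g.
Definition series_one : series := fun w => (w == [::])%:R.

Let mul_cons f g x w :
  series_mul f g (x :: w) = f [::] * g (x :: w) + series_mul (shift x f) g w.
Proof. by []. Qed.

Fact series_mulDl : left_distributive series_mul +%R.
Proof.
move=> f g h; apply/funext => w; rewrite seriesD.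
elim: w f g => [|x w IH] f g; first by rewrite /series_mul /= mulrDl.
by rewrite !mul_cons -[shift x _]/(shift x f + shift x g) IH seriesD mulrDl addrACA.
Qed.

Fact series_mulDr : right_distributive series_mul +%R.
Proof.
move=> f g h; apply/funext => w; rewrite seriesD.
elim: w f => [|x w IH] f; first by rewrite /series_mul /= mulrDr.
by rewrite !mul_cons IH seriesD mulrDr addrACA.
Qed.

Let mulZl (a : R) f g w : series_mul (fun v => a * f v) g w = a * series_mul f g w.
Proof.
elim: w f => [|x w IH] f; first by rewrite /series_mul /= mulrA.
by rewrite !mul_cons (IH (shift x f)) mulrDr mulrA.
Qed.

Fact series_mulA : associative series_mul.
Proof.
move=> f g h; apply/funext => w.
elim: w f g => [|x w IH] f g; first by rewrite /series_mul /= mulrA.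
rewrite !mul_cons IH.
have -> : shift x (series_mul f g) =
    (fun v => f [::] * shift x g v) + series_mul (shift x f) g by [].
rewrite series_mulDl seriesD mulZl !mulrDr addrA; congr (_ + _ + _).
by rewrite mulrA.
Qed.

Fact series_mul0 g w : series_mul 0 g w = 0.
Proof.
elim: w => [|x w IH]; first by rewrite /series_mul /= mul0r.
by rewrite mul_cons -[shift x 0]/(0 : series) IH mul0r addr0.
Qed.

Fact series_mul1l : left_id series_one series_mul.
Proof.
move=> f; apply/funext => -[|x w]; first by rewrite /series_mul /= mul1r.
by rewrite mul_cons -[shift x _]/(0 : series) series_mul0 mul1r addr0.
Qed.

Fact series_mul1r : right_id series_one series_mul.
Proof.
move=> f; apply/funext => w; elim: w f => [|x w IH] f; first by rewrite /series_mul /= mulr1.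
by rewrite mul_cons IH mulr0 add0r.
Qed.

Fact series_one_neq0 : series_one != 0.
Proof. by apply/eqP => /(congr1 (fun f : series => f [::]))/eqP; rewrite oner_eq0. Qed.

HB.instance Definition _ := GRing.Zmodule_isNzRing.Build series
  series_mulA series_mul1l series_mul1r series_mulDl series_mulDr series_one_neq0.

Lemma series1 w : (1 : series) w = (w == [::])%:R. Proof. by []. Qed.
Lemma seriesM_nil f g : (f * g) [::] = f [::] * g [::]. Proof. by []. Qed.
Lemma seriesM_cons f g x w :
  (f * g) (x :: w) = f [::] * g (x :: w) + (shift x f * g) w.
Proof. by []. Qed.

(** The series without terms of degree less than n. *)
Definition deg_ge n f := forall w, (size w < n)%N -> f w = 0.

Lemma deg_ge0 f : deg_ge 0 f. Proof. by []. Qed.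

Lemma deg_geD n f g : deg_ge n f -> deg_ge n g -> deg_ge n (f + g).
Proof. by move=> nf ng w wn; rewrite seriesD nf ?ng ?addr0. Qed.

Lemma deg_geN n f : deg_ge n f -> deg_ge n (- f).
Proof. by move=> nf w wn; rewrite seriesN nf ?oppr0. Qed.

Lemma deg_geB n f g : deg_ge n f -> deg_ge n g -> deg_ge n (f - g).
Proof. by move=> nf /deg_geN; exact: deg_geD. Qed.

Lemma deg_ge_le m n f : (m <= n)%N -> deg_ge n f -> deg_ge m f.
Proof. by move=> mn nf w wm; apply: nf; exact: leq_trans wm mn. Qed.

Lemma deg_geM m n f g : deg_ge m f -> deg_ge n g -> deg_ge (m + n) (f * g).
Proof.
move=> + ng w; elim: w m f => [|x w IH] m f mf wmn.
  case: m mf wmn => [|m] mf wmn; first by rewrite seriesM_nil ng ?mulr0.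
  by rewrite seriesM_nil mf ?mul0r.
rewrite seriesM_cons; case: m mf wmn => [|m] mf wmn.
  by rewrite ng // mulr0 add0r; apply: (IH 0%N) => //; exact: ltnW.
by rewrite mf // mul0r add0r; apply: (IH m) => // v vm; exact: mf.
Qed.

Lemma deg_geMl n f g : deg_ge n g -> deg_ge n (f * g).
Proof. by move=> ng; apply: (@deg_geM 0). Qed.

Lemma deg_geMr n f g : deg_ge n f -> deg_ge n (f * g).
Proof. by move=> nf; rewrite -[n]addn0; apply: deg_geM. Qed.

Lemma deg_geMn n f k : deg_ge n f -> deg_ge n (f *+ k).
Proof. by move=> nf w wn; rewrite seriesMn nf ?mul0rn. Qed.

Lemma deg_geX f k : deg_ge 1 f -> deg_ge k (f ^+ k).
Proof.
move=> f1; elim: k => // k IH; rewrite exprS; exact: (deg_geM f1 IH).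
Qed.

Lemma deg_ge_sum n (I : Type) (r : seq I) (P : pred I) (E : I -> series) :
  (forall i, P i -> deg_ge n (E i)) -> deg_ge n (\sum_(i <- r | P i) E i).
Proof. by move=> H; apply: (big_ind (deg_ge n)) => //; exact: deg_geD. Qed.

Definition homog n f := forall w, size w != n -> f w = 0.

Lemma homog_deg_ge n f : homog n f -> deg_ge n f.
Proof. by move=> hf w wn; apply: hf; rewrite ltn_eqF. Qed.

(** When f is homogeneous, only one factorization of the word contributes. *)
Lemma homog_mulE n f g u v : homog n f -> size u = n -> (f * g) (u ++ v) = f u * g v.
Proof.
elim: u n f => [|x u IH] n f hf szu; last first.
  rewrite cat_cons seriesM_cons hf -?szu // mul0r add0r.
  apply: (IH (size u)) => // w wu; apply: hf; by rewrite -szu.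
case: v => [|x v] //=; rewrite seriesM_cons (_ : shift x f = 0) ?mul0r ?addr0 //.
by apply/funext => w; apply: hf; rewrite -szu.
Qed.

Lemma homogM m n f g : homog m f -> homog n g -> homog (m + n) (f * g).
Proof.
move=> hf hg w wmn; have [mw|mw] := leqP m (size w).
  rewrite -(cat_take_drop m w) (homog_mulE _ _ hf) ?size_takel //.
  by rewrite (hg (drop m w)) ?mulr0 // size_drop; lia.
by have := @deg_geM m 0 f g (homog_deg_ge hf) (@deg_ge0 g); apply; rewrite addn0.
Qed.

Lemma homogB n f g : homog n f -> homog n g -> homog n (f - g).
Proof. by move=> hf hg w wn; rewrite seriesD seriesN hf ?hg ?subr0. Qed.

Definition monomial x : series := fun w => (w == [:: x])%:R.

Lemma homog_monomial x : homog 1 (monomial x).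
Proof. by move=> w w1; rewrite /monomial; case: eqP => // wE; rewrite wE in w1. Qed.

End Series.

End PowerSeries.

(** * Lie polynomials of Lyndon words *)

Section LiePolynomials.
Local Open Scope classical_set_scope.
Local Open Scope ring_scope.

Section LyndonPolynomials.
Context {d : Order.disp_t} {T : orderType d}.
Variables (R : nzRingType) (good : pred T).
Local Notation series := (series T R).

(** The variables outside good are set to 0: this allows for generators of
    different orders over one coefficient ring. *)
Definition letter_series (x : T) : series := if good x then monomial R x else 0.
Definition lie_bracket (f g : series) : series := f * g - g * f.
Definition lie_poly : seq T -> series := bracket lie_bracket letter_series 0.

Lemma lie_poly1 x : lie_poly [:: x] = letter_series x. Proof. by []. Qed.

Lemma lie_polyE w : (1 < size w)%N ->
  lie_poly w = lie_poly (std_left w) * lie_poly (std_right w)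
          - lie_poly (std_right w) * lie_poly (std_left w).
Proof. by move=> w1; rewrite /lie_poly bracketE. Qed.

Lemma homog_lie_poly w : lyndon w -> homog (size w) (lie_poly w).
Proof.
elim/(@lyndon_ind _ T): w / => [x|w Lw w1 _ _ IHl IHr].
  rewrite lie_poly1 /letter_series; case: ifP => // _; exact: homog_monomial.
rewrite lie_polyE // -{1}(std_cat w1) size_cat; apply: homogB; first exact: homogM.
by rewrite addnC; exact: homogM.
Qed.

Lemma lie_poly_bad w : lyndon w -> ~~ all good w -> lie_poly w = 0.
Proof.
elim/(@lyndon_ind _ T): w / => [x|w Lw w1 _ _ IHl IHr].
  by rewrite /= andbT lie_poly1 /letter_series => /negbTE->.
rewrite -{1}(std_cat w1) all_cat lie_polyE // negb_and => /orP[/IHl->|/IHr->];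
  by rewrite mul0r mulr0 subrr.
Qed.

Let lexi_cat_cases (u u' v v' : seq T) : size u = size u' ->
  (u ++ v < u' ++ v')%O -> (u < u')%O \/ (u = u' /\ (v < v')%O).
Proof.
move=> szu uv; case: (ltgtP u u') => [|u'u|uE]; [by left | | right].
  have := lexi_cat v' v (eq_leq szu) u'u.
  by move/(lt_trans uv); rewrite ltxx.
by split=> //; move: uv; rewrite uE lexi_cat2l.
Qed.

(** The Lie polynomial of w is w plus larger words.  In the product of the
    polynomials of the two factors u and r, a word below w = u ++ r would have
    a prefix below u or a suffix below r; the opposite product only contains
    words from r ++ u on, and r ++ u > w because w is Lyndon. *)
Lemma lie_poly_triangular w v : lyndon w -> size v = size w ->
  ((v < w)%O -> lie_poly w v = 0) /\ lie_poly w w = (all good w)%:R.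
Proof.
move=> Lw; elim/(@lyndon_ind _ T): w / Lw v => [x|w Lw w1 Ll Lr IHl IHr] v.
  case: v => [|y [|]] // _; rewrite lie_poly1 /letter_series /= andbT.
  case: ifP => _; last by [].
  rewrite /monomial eqxx; split=> //.
  by case: eqVneq => [[->]|//]; rewrite ltxx.
set u := std_left w in Ll IHl *; set r := std_right w in Lr IHr *.
have wE : w = u ++ r by rewrite std_cat.
have ur0 : size w = (size u + size r)%N by rewrite wE size_cat.
have hu := homog_lie_poly Ll; have hr := homog_lie_poly Lr.
have u0 := lyndon_neq0 Ll; have r0 := lyndon_neq0 Lr.
have ABE z : size z = size w ->
    (lie_poly u * lie_poly r) z = lie_poly u (take (size u) z) * lie_poly r (drop (size u) z).
  move=> szz; rewrite -{1}(cat_take_drop (size u) z) (homog_mulE _ _ hu) //.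
  by rewrite size_takel // szz ur0 leq_addr.
have BAE z : size z = size w ->
    (lie_poly r * lie_poly u) z = lie_poly r (take (size r) z) * lie_poly u (drop (size r) z).
  move=> szz; rewrite -{1}(cat_take_drop (size r) z) (homog_mulE _ _ hr) //.
  by rewrite size_takel // szz ur0 leq_addl.
have BA0 z : size z = size w -> (z <= w)%O -> (lie_poly r * lie_poly u) z = 0.
  move=> szz zw; rewrite BAE //.
  have sz1 : size (take (size r) z) = size r by rewrite size_takel // szz ur0 leq_addl.
  have sz2 : size (drop (size r) z) = size u by rewrite size_drop szz ur0 addnK.
  have : (take (size r) z ++ drop (size r) z < r ++ u)%O.
    rewrite cat_take_drop; apply: le_lt_trans zw _; rewrite wE.
    by apply: lyndon_rot => //; rewrite -wE.
  case/(lexi_cat_cases sz1) => [z1|[_ z2]].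
    by rewrite (IHr _ sz1).1 ?mul0r.
  by rewrite (IHl _ sz2).1 ?mulr0.
move=> szv; rewrite lie_polyE //; split=> [vw|].
  rewrite seriesD seriesN BA0 ?subr0 // 1?ltW // ABE //.
  have sz1 : size (take (size u) v) = size u by rewrite size_takel // szv ur0 leq_addr.
  have sz2 : size (drop (size u) v) = size r by rewrite size_drop szv ur0 addKn.
  move: (vw); rewrite {1}wE -{1}(cat_take_drop (size u) v).
  case/(lexi_cat_cases sz1) => [z1|[_ z2]].
    by rewrite (IHl _ sz1).1 ?mul0r.
  by rewrite (IHr _ sz2).1 ?mulr0.
rewrite seriesD seriesN BA0 ?subr0 // ABE //.
rewrite wE take_size_cat // drop_size_cat // (IHl u erefl).2 (IHr r erefl).2.
by rewrite all_cat; case: (all _ u); rewrite ?mul1r ?mul0r.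
Qed.

End LyndonPolynomials.

Section LyndonIndependence.
Context {d : Order.disp_t} {T : finOrderType d}.
Variables (R : nzRingType) (good : pred T) (k : nat).

(** By triangularity: at the smallest word where the exponents could differ,
    the coefficients of both sides involve no other unknown. *)
Lemma lie_poly_free (a b : @lyndon_word d T k -> nat) :
  \sum_(w : @lyndon_word d T k) lie_poly R good (val (val w)) *+ a w =
  \sum_(w : @lyndon_word d T k) lie_poly R good (val (val w)) *+ b w ->
  forall w : @lyndon_word d T k, all good (val (val w)) -> (a w)%:R = (b w)%:R :> R.
Proof.
move=> E w; pose P n := forall w : @lyndon_word d T k,
  #|[pred v : k.-tuple T | (val v < val (val w) :> seq T)%O]| = n ->
  all good (val (val w)) -> (a w)%:R = (b w)%:R :> R.
suff: P #|[pred v : k.-tuple T | (val v < val (val w) :> seq T)%O]| by apply.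
elim/ltn_ind: #|_| => {w} n IH w wn gw.
have coef (c : @lyndon_word d T k -> nat) :
    (\sum_(v : @lyndon_word d T k) lie_poly R good (val (val v)) *+ c v) (val (val w)) =
    (c w)%:R + \sum_(v : @lyndon_word d T k | (val (val v) < val (val w) :> seq T)%O)
       lie_poly R good (val (val v)) (val (val w)) * (c v)%:R.
  rewrite series_sum (bigD1 w) //= seriesMn; congr (_ + _).
    by rewrite (lie_poly_triangular R good (valP w) erefl).2 gw.
  rewrite big_mkcond [RHS]big_mkcond; apply: eq_bigr => v _.
  case: eqVneq => [->|vw] /=; first by rewrite ltxx.
  rewrite seriesMn -[X in X = _]mulr_natr.
  case: (ltgtP (val (val v) : seq T) (val (val w))) => // [wv|vwE].
    by rewrite (lie_poly_triangular R good (valP v) _).1 ?mul0r ?size_tuple.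
  by case/eqP: vw; apply: val_inj; apply: val_inj.
have := congr1 (fun f : series T R => f (val (val w))) E; rewrite !coef.
suff -> : \sum_(v : @lyndon_word d T k | (val (val v) < val (val w) :> seq T)%O)
       lie_poly R good (val (val v)) (val (val w)) * (a v)%:R =
     \sum_(v : @lyndon_word d T k | (val (val v) < val (val w) :> seq T)%O)
       lie_poly R good (val (val v)) (val (val w)) * (b v)%:R by move/addIr.
apply: eq_bigr => v vw.
case: (boolP (all good (val (val v)))) => gv; last first.
  by rewrite lie_poly_bad ?mul0r ?(valP v).
congr (_ * _); apply: (IH _ _ v erefl gv); rewrite -wn.
apply: proper_card; apply/properP; split.
  by apply/fintype.subsetP => z; rewrite !inE => /lt_trans; apply.
by exists (val v); rewrite !inE ?ltxx.
Qed.

End LyndonIndependence.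

End LiePolynomials.

(** * The Magnus group *)

Section MagnusRepresentation.
Local Open Scope classical_set_scope.
Local Open Scope ring_scope.

Section RingIdentities.
Variable A : nzRingType.
Implicit Types a b : A.

Lemma commutator_add1 a b : (1 + a) * (1 + b) - (1 + b) * (1 + a) = a * b - b * a.
Proof.
rewrite !mulrDl !mulrDr !mul1r !mulr1 !addrA [1 + a + b]addrAC.
by rewrite opprD addrACA subrr add0r.
Qed.

Lemma mul_add1 a b : (1 + a) * (1 + b) - 1 = a * b + a + b.
Proof.
rewrite mulrDl !mulrDr !mul1r !mulr1 -(addrA 1 b) [1 + (b + _)]addrC addrK.
by rewrite addrC [a + _]addrC.
Qed.

End RingIdentities.

Section MagnusGroup.
Variables (T : eqType) (R : nzRingType).
Local Notation series := (series T R).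

(** The invertible series with constant term 1.  The inverse is part of the
    data, so that the group structure requires no inversion of series. *)
Record magnus := Magnus {
  mval : series;
  minv : series;
  mvalK : mval * minv = 1;
  minvK : minv * mval = 1;
  mval_nil : mval [::] = 1 }.

Lemma mval_inj : injective mval.
Proof.
case=> a a' aa' a'a a1 [b b' bb' b'b b1] /= ab; subst b.
have ab' : a' = b' by rewrite -[a']mulr1 -bb' mulrA a'a mul1r.
by subst b'; congr Magnus; exact: Prop_irrelevance.
Qed.

Lemma minv_nil (u : magnus) : minv u [::] = 1.
Proof.
have := congr1 (fun f : series => f [::]) (mvalK u).
by rewrite seriesM_nil mval_nil mul1r.
Qed.

HB.instance Definition _ := gen_eqMixin magnus.
HB.instance Definition _ := gen_choiceMixin magnus.

Definition magnus_one : magnus :=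
  @Magnus 1 1 (mulr1 1) (mulr1 1) erefl.

Fact magnus_mulK (u v : magnus) : (mval u * mval v) * (minv v * minv u) = 1.
Proof. by rewrite mulrA -(mulrA (mval u)) mvalK mulr1 mvalK. Qed.
Fact magnus_mulVK (u v : magnus) : (minv v * minv u) * (mval u * mval v) = 1.
Proof. by rewrite mulrA -(mulrA (minv v)) minvK mulr1 minvK. Qed.
Fact magnus_mul_nil (u v : magnus) : (mval u * mval v) [::] = 1.
Proof. by rewrite seriesM_nil !mval_nil mulr1. Qed.

Definition magnus_mul (u v : magnus) : magnus :=
  Magnus (magnus_mulK u v) (magnus_mulVK u v) (magnus_mul_nil u v).
Definition magnus_inv (u : magnus) : magnus :=
  Magnus (minvK u) (mvalK u) (minv_nil u).

Fact magnus_mulA : associative magnus_mul.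
Proof. by move=> u v w; apply: mval_inj; rewrite /= mulrA. Qed.
Fact magnus_mul1g : left_id magnus_one magnus_mul.
Proof. by move=> u; apply: mval_inj; rewrite /= mul1r. Qed.
Fact magnus_mulg1 : right_id magnus_one magnus_mul.
Proof. by move=> u; apply: mval_inj; rewrite /= mulr1. Qed.
Fact magnus_mulVg : left_inverse magnus_one magnus_inv magnus_mul.
Proof. by move=> u; apply: mval_inj; rewrite /= minvK. Qed.
Fact magnus_mulgV : right_inverse magnus_one magnus_inv magnus_mul.
Proof. by move=> u; apply: mval_inj; rewrite /= mvalK. Qed.

HB.instance Definition _ := isGroup.Build magnus
  magnus_mulA magnus_mul1g magnus_mulg1 magnus_mulVg magnus_mulgV.

Lemma mvalM (u v : magnus) : mval (u * v)%g = mval u * mval v. Proof. by []. Qed.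
Lemma mvalV (u : magnus) : mval u^-1%g = minv u. Proof. by []. Qed.
Lemma mvalX (u : magnus) n : mval (u ^+ n)%g = mval u ^+ n.
Proof. by elim: n => [|n IH]; rewrite ?expr0 // expgS exprS mvalM IH. Qed.

(** The filtration of the group by the degree of u - 1; it is compatible with
    the lower central series. *)
Definition mdeg k : set magnus := [set u | deg_ge k (mval u - 1)].

Lemma mdeg_normal k : is_normal (mdeg k).
Proof.
rewrite /mdeg; split; first split=> /= [|u v ku kv|u ku].
- by rewrite subrr.
- have -> : mval u * mval v - 1 = (mval u - 1) * mval v + (mval v - 1).
    by rewrite mulrBl mul1r addrA subrK.
  by apply: deg_geD => //; exact: deg_geMr.
- have -> : minv u - 1 = - (minv u * (mval u - 1)).
    by rewrite mulrBr mulr1 minvK opprB.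
  by apply: deg_geN; exact: deg_geMl.
move=> u v /= ku.
have -> : minv v * (mval u * mval v) - 1 = minv v * ((mval u - 1) * mval v).
  by rewrite mulrBl mul1r mulrBr minvK.
by apply: deg_geMl; exact: deg_geMr.
Qed.

Lemma mdeg1 u : mdeg 1 u.
Proof. by move=> [|x w] // _; rewrite seriesD seriesN mval_nil series1 subrr. Qed.

Lemma mdeg_le m k : (m <= k)%N -> mdeg k `<=` mdeg m.
Proof. by move=> mk u; exact: deg_ge_le. Qed.

(** u is 1 + f modulo degree k.+1; f may vanish, so lead k u 0 says that
    u - 1 starts in degree k.+1. *)
Definition lead k (u : magnus) (f : series) := deg_ge k f /\ deg_ge k.+1 (mval u - 1 - f).

Lemma lead_mdeg k u f : lead k u f -> mdeg k u.
Proof.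
case=> kf kuf; rewrite /mdeg /= -[mval u - 1](subrK f); apply: deg_geD => //.
exact: deg_ge_le kuf.
Qed.

Lemma mdeg_lead k u : mdeg k.+1 u -> lead k u 0.
Proof. by move=> ku; split=> //; rewrite subr0. Qed.

(** The leading form of a group commutator is the Lie bracket of the leading
    forms: with u = 1 + U and v = 1 + V, one has uv - vu = UV - VU, and
    [u, v] - 1 is this difference multiplied by a series with constant term
    1. *)
Lemma lead_comm i j u v f g : (0 < i)%N -> (0 < j)%N -> lead i u f -> lead j v g ->
  lead (i + j) [~ u, v]%g (f * g - g * f).
Proof.
move=> i0 j0 lu lv; have iu := lead_mdeg lu; have jv := lead_mdeg lv.
case: lu lv => fi uf [gj vg].
have cE n m h h' : deg_ge m h -> deg_ge n h' -> deg_ge (m + n) (h' * h).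
  by move=> mh nh'; rewrite addnC; exact: deg_geM.
split; first by apply: deg_geB; [exact: deg_geM | exact: cE].
rewrite /mdeg /= in iu jv.
set U := mval u - 1 in iu uf; set V := mval v - 1 in jv vg.
have uE : mval u = 1 + U by rewrite addrC subrK.
have vE : mval v = 1 + V by rewrite addrC subrK.
clearbody U V.
have E : mval [~ u, v]%g - 1 = minv u * minv v * (U * V - V * U).
  rewrite -commutator_add1 -uE -vE mulrBr (magnus_mulVK v u).
  by rewrite /commg /conjg !mvalM !mvalV !mulrA.
set M := U * V - V * U in E.
have -> : mval [~ u, v]%g - 1 - (f * g - g * f) =
    (minv u * minv v - 1) * M + (M - (f * g - g * f)).
  by rewrite E mulrBl mul1r addrA subrK.
have -> : M - (f * g - g * f) =
    ((U - f) * V + f * (V - g)) - ((V - g) * U + g * (U - f)).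
  by rewrite !mulrBl !mulrBr !addrA !subrK !opprD addrACA.
apply: deg_geD; last apply: deg_geB.
- rewrite -[(i + j).+1]add1n; apply: deg_geM.
    exact: (@mdeg1 (u^-1 * v^-1)%g).
  by apply: deg_geB; [exact: deg_geM | exact: cE].
- apply: deg_geD; first by rewrite -addSn; exact: deg_geM.
  by rewrite -addnS; exact: deg_geM.
- apply: deg_geD; first by rewrite -addnS; exact: cE.
  by rewrite -addSn; exact: cE.
Qed.

Lemma lead_mul k u v f g : (0 < k)%N -> lead k u f -> lead k v g -> lead k (u * v)%g (f + g).
Proof.
move=> k0 lu lv; have ku := lead_mdeg lu; have kv := lead_mdeg lv.
case: lu lv => kf uf [kg vg]; split; first exact: deg_geD.
rewrite /mdeg /= in ku kv.
set U := mval u - 1 in ku uf; set V := mval v - 1 in kv vg.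
have uE : mval u = 1 + U by rewrite addrC subrK.
have vE : mval v = 1 + V by rewrite addrC subrK.
clearbody U V.
have -> : mval (u * v)%g - 1 - (f + g) = U * V + (U - f) + (V - g).
  rewrite mvalM uE vE mul_add1 opprD -!addrA; congr (_ + (_ + _)).
  by rewrite addrCA.
apply: deg_geD => //; apply: deg_geD => //.
by apply: (@deg_ge_le _ _ _ (k + k)); [rewrite -addn1 leq_add2l | exact: deg_geM].
Qed.

Lemma lead1 k : lead k 1%g 0.
Proof. by apply: mdeg_lead; case: (mdeg_normal k.+1) => -[]. Qed.

Lemma leadX k u f n : (0 < k)%N -> lead k u f -> lead k (u ^+ n)%g (f *+ n).
Proof.
move=> k0 lu; elim: n => [|n IH]; first exact: lead1.
by rewrite expgS mulrS; exact: lead_mul.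
Qed.

Lemma lead_prod k (I : Type) (r : seq I) (u : I -> magnus) (f : I -> series) :
  (0 < k)%N -> (forall i, lead k (u i) (f i)) ->
  lead k (\prod_(i <- r) u i)%g (\sum_(i <- r) f i).
Proof.
move=> k0 H; apply: (big_ind2 (lead k)) => //; first exact: lead1.
by move=> *; exact: lead_mul.
Qed.

Lemma lead_self k u : mdeg k u -> lead k u (mval u - 1).
Proof. by move=> ku; split=> //; rewrite subrr. Qed.

Lemma mdeg_comm i j u v : (0 < i)%N -> (0 < j)%N -> mdeg i u -> mdeg j v ->
  mdeg (i + j) [~ u, v]%g.
Proof.
by move=> i0 j0 /lead_self lu /lead_self lv; exact: lead_mdeg (lead_comm i0 j0 lu lv).
Qed.

Lemma mdeg_iter_commutator i k (N : set magnus) : (0 < i)%N -> N `<=` mdeg i ->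
  iter_commutator k N `<=` mdeg (i + k).
Proof.
move=> i0 Ni; elim: k => [|k IH] /=; first by rewrite addn0.
apply: (commutator_min (mdeg_normal _).1) => u v /IH ku _.
rewrite addnS -addn1; apply: mdeg_comm => //; first by rewrite addn_gt0 i0.
exact: mdeg1.
Qed.

Lemma gamma_mdeg k : (0 < k)%N -> lower_central magnus k `<=` mdeg k.
Proof.
case: k => // k _; rewrite -[in mdeg _]add1n.
by apply: mdeg_iter_commutator => // u _; exact: mdeg1.
Qed.

Section Generators.
Variable x : T.

(** The geometric series of -x, which inverts 1 + x. *)
Let geom : series := fun w => (all (pred1 x) w)%:R * (-1) ^+ size w.

Let shift_x z : shift z (1 + monomial R x) = (z == x)%:R * 1.
Proof.
apply/funext => w; rewrite /shift seriesD series1 /monomial add0r.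
rewrite eqseq_cons; case: (z == x); last by rewrite mul0r.
by rewrite mul1r.
Qed.

Let shift_geom z : shift z geom = - ((z == x)%:R * geom).
Proof.
apply/funext => w; rewrite seriesN /shift /geom /= exprS.
case: (z == x) => /=; last by rewrite !mul0r oppr0.
by rewrite mul1r mulN1r mulrN.
Qed.

Fact gen_mulK : (1 + monomial R x) * geom = 1.
Proof.
apply/funext => -[|z w].
  by rewrite seriesM_nil seriesD series1 /monomial /geom /= addr0 !mul1r.
rewrite seriesM_cons shift_x -mulrA mul1r -[geom _]/(shift z geom w) shift_geom.
by rewrite seriesD series1 /monomial /= addr0 mul1r seriesN addNr.
Qed.

Fact gen_mulVK : geom * (1 + monomial R x) = 1.
Proof.
apply/funext => w; elim: w => [|z w IH].
  by rewrite seriesM_nil seriesD series1 /monomial /geom /= addr0 !mul1r.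
rewrite seriesM_cons shift_geom mulNr seriesN -mulrA.
have -> : (1 + monomial R x) (z :: w) = ((z == x)%:R * 1 : series) w.
  by rewrite -shift_x.
rewrite /geom /= !mul1r mulr1 -/geom.
case: (z == x); last by rewrite !mul0r subrr.
by rewrite !mul1r IH subrr.
Qed.

Fact gen_nil : (1 + monomial R x) [::] = 1.
Proof. by rewrite seriesD series1 /monomial addr0. Qed.

Definition magnus_gen : magnus := Magnus gen_mulK gen_mulVK gen_nil.

Lemma lead_gen : lead 1 magnus_gen (monomial R x).
Proof.
split; first exact: homog_deg_ge (@homog_monomial _ _ x).
by rewrite /= [1 + _]addrC addrK subrr.
Qed.

(** The binomial expansion of (1 + x) ^ q: the terms of positive degree at
    most n vanish by hypothesis. *)
Lemma magnus_genX q n : (forall i, (0 < i <= n)%N -> ('C(q, i))%:R = 0 :> R) ->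
  mdeg n.+1 (magnus_gen ^+ q)%g.
Proof.
move=> Cq; rewrite /mdeg /= mvalX /= [1 + monomial _ _]addrC exprD1n big_ord_recl /= expr0 bin0 mulr1n.
rewrite [1 + _]addrC addrK.
apply: deg_ge_sum => i _; rewrite /bump /= add1n.
have [ni|ni] := ltnP n i.+1.
  apply: deg_geMn; apply: (deg_ge_le ni); apply: deg_geX.
  exact: homog_deg_ge (@homog_monomial _ _ x).
by move=> w _; rewrite seriesMn -mulr_natr Cq ?mulr0.
Qed.

End Generators.

End MagnusGroup.

(** From i * C(q, i) = q * C(q - 1, i - 1), as i is prime to p. *)
Lemma dvdn_bin_prime_power p b i : prime p -> (0 < i < p)%N -> (p ^ b %| 'C(p ^ b, i))%N.
Proof.
move=> pp /andP[i0 ip].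
have co : coprime (p ^ b) i.
  by rewrite coprimeXl // prime_coprime // gtnNdvd.
rewrite -(Gauss_dvdr _ co); case: i i0 {ip co} => // i _.
by rewrite -mul_bin_diag dvdn_mulr.
Qed.

End MagnusRepresentation.

(** * Nilpotent products of cyclic groups *)

Section NilpotentProducts.
Local Open Scope classical_set_scope.
Local Open Scope group_scope.

Section MoreGroups.

(** Modulo a normal subgroup, commutation with a fixed element is a subgroup
    property, in each argument. *)
Lemma normal_comm_generated (G : groupType) (N X Y : set G) x y : is_normal N ->
  (forall a b, X a -> Y b -> N [~ a, b]) ->
  generated_subgroup X x -> generated_subgroup Y y -> N [~ x, y].
Proof.
move=> nN H; have [[N1 NM NV] NJ] := nN; have sN := nN.1.
have left b : (forall a, X a -> N [~ a, b]) -> generated_subgroup X `<=` [set a | N [~ a, b]].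
  move=> Xb; apply: generated_min => [|a Xa] /=; last exact: Xb.
  split=> /= [|u v Nu Nv|u Nu]; rewrite ?comm1g ?comm_mulgl ?comm_invgl //.
    by apply: NM => //; exact: NJ.
  by apply: NV; exact: NJ.
move=> Xx; have {}Xx b : (forall a, X a -> N [~ a, b]) -> N [~ x, b] by move/left; apply.
suff : generated_subgroup Y `<=` [set b | N [~ x, b]] by apply.
apply: generated_min => [|b Yb] /=; last by apply: Xx => a Xa; exact: H.
split=> /= [|u v Nu Nv|u Nu]; first by rewrite commg1.
  by rewrite comm_mulgr; apply: NM => //; exact: NJ.
apply: (subgroup_commC sN); rewrite comm_invgl; apply: NV; apply: NJ.
exact: (subgroup_commC sN).
Qed.

Lemma generated_image (G H : groupType) (f : {multiplicative G -> H}) (X : set G) x :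
  generated_subgroup X x -> generated_subgroup (f @` X) (f x).
Proof.
move: x; apply: (generated_min (preimage_subgroup f (is_subgroup_generated _))).
by move=> x Xx; apply: sub_generated; exists x.
Qed.

Lemma gamma_surj (G H : groupType) (f : {multiplicative G -> H}) k :
  (forall y, exists x, f x = y) -> lower_central H k `<=` f @` lower_central G k.
Proof.
move=> fs; rewrite /lower_central; elim: k.-1 => [|l IH] /=.
  by move=> y _; have [x <-] := fs y; exists x.
have [C1 CM CV] := is_subgroup_generated
  [set z | exists2 x, iter_commutator l [set: G] x & exists2 y, setT y & z = [~ x, y]].
apply: commutator_min.
  split=> [|_ _ [x Cx <-] [y Cy <-]|_ [x Cx <-]].
  - by exists 1; rewrite ?hom1.
  - by exists (x * y); rewrite ?gmulfM //; exact: CM.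
  - by exists x^-1; rewrite ?homV //; exact: CV.
move=> _ b /IH[x Cx <-] _; have [y <-] := fs b.
by exists [~ x, y]; rewrite ?homR //; exact: mem_commutator.
Qed.

End MoreGroups.

Section FreeProductMap.
Variables (I : choiceType) (G : I -> groupType) (H : groupType).
Variable f : forall i, {multiplicative G i -> H}.

Definition letter_map (a : letter G) : H := let: existT i x := a in f i x.
(** The universal property of the free product: a word is sent to the product
    of the images of its letters. *)
Definition word_map (u : seq (letter G)) : H := \prod_(a <- u) letter_map a.

Lemma word_map_eq u v : word_eq u v -> word_map u = word_map v.
Proof.
elim=> {u v} // [u v w _ -> _ -> //|u v i|u v i x y]; rewrite /word_map !big_cat !big_cons /=.
  by rewrite hom1 mul1g.
by rewrite (@gmulfM _ _ (f i) x y) -!mulgA.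
Qed.

Definition fp_map (X : free_product G) : H := word_map (fp_repr X).

Lemma fp_map_class u : fp_map (fp_class u) = word_map u.
Proof. by apply: word_map_eq; apply/fp_classP; rewrite fp_reprK. Qed.

Fact fp_mapM : {morph fp_map : X Y / X * Y}.
Proof.
move=> X Y; rewrite -[X in X * _]fp_reprK -[Y in _ * Y]fp_reprK.
by rewrite -[_ * _]fp_class_cat fp_map_class /word_map big_cat.
Qed.

HB.instance Definition _ := isMultiplicative.Build (free_product G) H fp_map fp_mapM.

Lemma fp_map_inj i (x : G i) : fp_map (fp_inj x) = f i x.
Proof. by rewrite fp_map_class /word_map big_seq1. Qed.

End FreeProductMap.

Section CyclicMap.
Variables (r : nat) (H : groupType) (h : H).
Hypotheses (r1 : (1 < r)%N) (hr : h ^+ r = 1).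

Definition cyclic_map (x : cyclic_group r) : H := h ^+ (x : 'Z_r).

Lemma expg_modr m : h ^+ (m %% r) = h ^+ m.
Proof. by rewrite [in RHS](divn_eq m r) expgnDr mulnC expgnA hr expg1n mul1g. Qed.

Fact cyclic_mapM : {morph cyclic_map : x y / x * y}.
Proof.
move=> x y; rewrite /cyclic_map -expgnDr -[RHS]expg_modr.
congr (_ ^+ _); move: r1 x y; rewrite /cyclic_group; case: (r) => [|[|r']] //.
Qed.


Lemma cyclic_map1 : cyclic_map (1%R : 'Z_r) = h.
Proof. by rewrite /cyclic_map; case: (r) r1 => [|[|r']]. Qed.

End CyclicMap.

Lemma cyclic_exp r (x : cyclic_group r) : (1%R : cyclic_group r) ^+ (x : 'Z_r) = x.
Proof. by rewrite -[LHS]/((1%R : 'Z_r) ^+ (x : 'Z_r)) FinRing.zmodXgE natr_Zp. Qed.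

Lemma cyclic_exp_order r : (1 < r)%N -> (1%R : cyclic_group r) ^+ r = 1.
Proof. by move=> r1; rewrite -[LHS]/((1%R : 'Z_r) ^+ r) FinRing.zmodXgE pchar_Zp. Qed.

Section NilpotentProductOfCyclics.
Variables (I : choiceType) (r : I -> nat) (n : nat).
Hypothesis r1 : forall i, (1 < r i)%N.
Let G (i : I) := cyclic_group (r i).
Local Notation P := (free_product G).
Local Notation NP := (nilpotent_product G n).

(** The generator 1 of the i-th cyclic factor, and its image in the nilpotent
    product. *)
Definition fp_gen (i : I) : P := @fp_inj I G i (1%R : 'Z_(r i)).
Definition np_gen (i : I) : NP := quot_map (nilpotent_kernel G n) (fp_gen i).

Lemma fp_generated x : generated_subgroup (range fp_gen) x.
Proof.
have sS := is_subgroup_generated (range fp_gen); have [S1 SM _] := sS.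
rewrite -(fp_reprK x); elim: (fp_repr x) => [|[i a] u IH] //.
rewrite -cat1s fp_class_cat; apply: SM => //.
rewrite -[fp_class _]/(@fp_inj I G i a) -(cyclic_exp a) homX.
by apply: (subgroupX _ sS); apply: sub_generated; exists i.
Qed.

Lemma np_generated x : generated_subgroup (range np_gen) x.
Proof.
have [z <-] := quot_map_surj x.
have := generated_image (f := quot_map (nilpotent_kernel G n)) (fp_generated z).
by apply: generatedS => _ [_ [i _ <-] <-]; exists i.
Qed.

Lemma np_gen_order i : np_gen i ^+ r i = 1.
Proof. by rewrite /np_gen /fp_gen -!homX /= cyclic_exp_order // !hom1. Qed.

(** The factors are abelian, so the free product modulo its cartesian subgroup
    is abelian.  Hence the cartesian subgroup contains the derived subgroup,
    and the nilpotent product is the free product modulo its term n.+1. *)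
Lemma np_class : (0 < n)%N -> lower_central NP n.+1 `<=` [set 1].
Proof.
move=> n0 x /(gamma_surj (f := quot_map (nilpotent_kernel G n)) (@quot_map_surj _ _)).
case=> z gz <-; apply/quot_map_eq1; split=> //=.
have nC : is_normal (@cartesian_subgroup I G) := is_normal_normal_closure _.
have {gz} : lower_central P 2 z by apply: gamma_leq gz.
rewrite /lower_central /=; apply: (commutator_min nC.1) => a b _ _.
apply: (normal_comm_generated nC _ (fp_generated a) (fp_generated b)).
move=> _ _ [i _ <-] [j _ <-]; case: (eqVneq i j) => [->|ij].
  by rewrite commgg; case: nC => -[].
move=> B [nB]; apply; exists i, j; split=> //.
by apply: mem_commutator; exists (1%R : 'Z_(r _)).
Qed.

(** The nilpotent product is the universal group of class n generated by
    elements of the given orders. *)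
Lemma np_lift (H : groupType) (h : I -> H) :
  lower_central H n.+1 `<=` [set 1] -> (forall i, h i ^+ r i = 1) ->
  exists phi : {multiplicative NP -> H}, forall i, phi (np_gen i) = h i.
Proof.
move=> Hn hr.
pose c i : {multiplicative G i -> H} :=
  HB.pack (cyclic_map (h i)) (isMultiplicative.Build (G i) H _ (cyclic_mapM (r1 i) (hr i))).
pose F : {multiplicative P -> H} := fp_map c.
pose phi (x : NP) : H := F (xget 1 [set z | quot_map (nilpotent_kernel G n) z = x]).
have phiE z : phi (quot_map (nilpotent_kernel G n) z) = F z.
  rewrite /phi; case: xgetP => [y _ /quot_mapP[+ _]|/(_ z)/=]; last by case.
  move=> /(hom_gamma F)/Hn /=; rewrite gmulfM homV => E.
  by rewrite -(mulg1_eq E) invgK.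
have phiM : {morph phi : x y / x * y}.
  move=> x y; have [a <-] := quot_map_surj x; have [b <-] := quot_map_surj y.
  by rewrite -gmulfM !phiE gmulfM.
pose Phi : {multiplicative NP -> H} :=
  HB.pack phi (isMultiplicative.Build NP H phi phiM).
exists Phi => i; rewrite /Phi /=.
by rewrite phiE /= fp_map_inj /= cyclic_map1.
Qed.

End NilpotentProductOfCyclics.

End NilpotentProducts.

(** * Enumerations, lifting and relations in a given weight *)

Section FreePresentations.
Local Open Scope classical_set_scope.
Local Open Scope group_scope.

Section Enumerations.
Variable T : Type.

(** Sets of cardinality N, in a form that composes well in inductions. *)
Definition enumerates (A : set T) (N : nat) : Prop :=
  exists g : 'I_N -> T, injective g /\ range g = A.

Lemma enumerates_card (A : set T) N : enumerates A N -> (A #= `I_N)%card.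
Proof.
case=> g [gI <-]; apply: (card_eq_trans (B := [set: 'I_N])).
  by apply: inj_card_eq => x y _ _; exact: gI.
by apply: card_esym; exact: card_II.
Qed.

Lemma enumerates_fin (D : finType) (A : set T) (g : D -> T) :
  injective g -> range g = A -> enumerates A #|D|.
Proof.
move=> gI <-; exists (fun i => g (enum_val i)); split.
  by move=> i j /gI /enum_val_inj.
apply/seteqP; split=> [_ [i _ <-]|_ [x _ <-]]; first by exists (enum_val i).
by exists (enum_rank x) => //; rewrite enum_rankK.
Qed.

End Enumerations.

(** A factor set A / B is represented by h, without repetition. *)
Lemma enumerates_step (G : groupType) (D : finType) (A B : set G) (h : D -> G) N :
  enumerates B N ->
  (forall x, A x <-> exists d, exists2 b, B b & x = h d * b) ->
  (forall d d' b b', B b -> B b' -> h d * b = h d' * b' -> d = d') ->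
  enumerates A (#|D| * N).
Proof.
case=> g [gI gB] AE hI; have Bg i : B (g i) by rewrite -gB; exists i.
pose k (x : D * 'I_N) := h x.1 * g x.2.
have -> : (#|D| * N)%N = #|{: D * 'I_N}| by rewrite card_prod card_ord.
apply: (enumerates_fin (g := k)) => [[d i] [d' i'] /= E|].
  have /= dd := hI _ _ _ _ (Bg i) (Bg i') E; rewrite /k /= -dd in E *.
  by move/mulgI/gI: E => ->.
apply/seteqP; split=> [_ [[d i] _ <-]|x].
  by apply/AE; exists d, (g i).
by case/AE => d [b]; rewrite -gB => -[i _ <-] ->; exists (d, i).
Qed.

Lemma hom_iter_commutator (G H : groupType) (f : {multiplicative G -> H}) k
    (N : set G) (M : set H) :
  N `<=` f @^-1` M -> iter_commutator k N `<=` f @^-1` (iter_commutator k M).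
Proof.
move=> NM; elim: k => //= k IH.
apply: commutator_min; first exact/preimage_subgroup/is_subgroup_generated.
by move=> x y /IH Nx _; rewrite /preimage /= homR; exact: mem_commutator.
Qed.

Lemma iter_commutator_le (G : groupType) (N : set G) i j : is_normal N ->
  (i <= j)%N -> iter_commutator j N `<=` iter_commutator i N.
Proof.
move=> nN /subnK <-; rewrite /iter_commutator iterD.
exact: iter_commutator_sub (is_normal_iter_commutator i nN).
Qed.

(** Free groups are projective: it suffices to lift the images of a basis. *)
Lemma free_lift (F A H : groupType) (q : {multiplicative A -> H})
    (g : {multiplicative F -> H}) :
  is_free_group F -> (forall y, exists x, q x = y) ->
  exists mu : {multiplicative F -> A}, forall x, q (mu x) = g x.
Proof.
move=> [X [b free_b]] q_surj.
have [s sE] := choice (fun x => q_surj (g (b x))).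
have [mu muE _] := free_b A s; exists mu.
have [phi _ uniq] := free_b H (g \o b).
pose qmu : {multiplicative F -> H} := q \o mu.
move=> x; rewrite (uniq g) //; apply: (uniq qmu) => z.
by rewrite /qmu /= muE sE.
Qed.

Section Relations.
Variables (F : groupType) (R : set F).
Hypothesis nR : is_normal R.
Local Notation gamma := (lower_central F).

(** The product of the term k.+1 of the lower central series with
    [R, F, ..., F] (F being repeated k - 1 times): the relations of weight k
    in the graded Lie ring of F that follow from those of R. *)
Definition rel_gamma (k : nat) : set F :=
  [set z | exists2 x, gamma k.+1 x & exists2 y, iter_commutator k.-1 R y & z = x * y].

Lemma rel_gamma_normal k : is_normal (rel_gamma k).
Proof.
have [[g1 gM gV] gJ] := is_normal_lower_central F k.+1.
have [[c1 cM cV] cJ] := is_normal_iter_commutator k.-1 nR.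
split; first split.
- by exists 1 => //; exists 1; rewrite ?mulg1.
- move=> _ _ [x gx [y cy ->]] [x' gx' [y' cy' ->]].
  exists (x * x' ^ y^-1); first by apply: gM => //; exact: gJ.
  exists (y * y'); first exact: cM.
  by rewrite conjgE invgK !mulgA mulgVK.
- move=> _ [x gx [y cy ->]]; exists x^-1; first exact: gV.
  by exists (y^-1 ^ x^-1); [exact/cJ/cV | rewrite conjgE invgK invgM mulKg].
move=> _ z [x gx [y cy ->]]; exists (x ^ z); first exact: gJ.
by exists (y ^ z); [exact: cJ | rewrite conjMg].
Qed.

Lemma gamma_rel_gamma k : gamma k.+1 `<=` rel_gamma k.
Proof.
move=> x gx; exists x => //; exists 1; last by rewrite mulg1.
by case: (is_normal_iter_commutator k.-1 nR) => -[].
Qed.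

Lemma rel_gamma_sub k : rel_gamma k `<=` gamma k.
Proof.
move=> _ [x gx [y cy ->]]; have [_ gM _] := gamma_group F k.
apply: gM; first exact: gamma_leq gx.
by rewrite /lower_central; apply: iter_commutatorS cy.
Qed.

Lemma rel_gamma_comm i j x z : (0 < i)%N -> (0 < j)%N ->
  rel_gamma i x -> gamma j z -> rel_gamma (i + j)%N [~ x, z].
Proof.
case: i j => // i [//|j] _ _ [a ga [b cb ->]] gz; rewrite comm_mulgl.
have [[_ LM _] LJ] := rel_gamma_normal (i.+1 + j.+1)%N.
apply: LM; first by apply: LJ; apply: gamma_rel_gamma; rewrite -addSn; exact: gamma_comm.
exists 1; first by case: (gamma_group F (i.+1 + j.+1).+1).
exists [~ b, z]; last by rewrite mul1g.
by rewrite addSn addnS /=; exact: iter_commutator_comm.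
Qed.

Lemma rel_gamma1 : R `<=` rel_gamma 1.
Proof.
by move=> x Rx; exists 1; [case: (gamma_group F 2) | exists x; rewrite ?mul1g].
Qed.

End Relations.

End FreePresentations.

(** * The order of the nilpotent multiplier *)

Section NilpotentMultiplier.
Local Open Scope classical_set_scope.
Local Open Scope group_scope.

Record is_nilpotent_product (I : Type) (r : I -> nat) (n : nat) (G : groupType)
    (g : I -> G) : Prop := IsNilpotentProduct {
  nilprod_order : forall i, g i ^+ r i = 1;
  nilprod_gen : forall x, generated_subgroup (range g) x;
  nilprod_class : lower_central G n.+1 `<=` [set 1];
  nilprod_lift : forall (H : groupType) (h : I -> H),
    lower_central H n.+1 `<=` [set 1] -> (forall i, h i ^+ r i = 1) ->
    exists phi : {multiplicative G -> H}, forall i, phi (g i) = h i }.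

Lemma isomorphic_nilpotent_product (I : choiceType) (r : I -> nat) (n : nat) (G : groupType) :
  (forall i, (1 < r i)%N) -> (0 < n)%N ->
  isomorphic G (nilpotent_product (fun i => cyclic_group (r i)) n) ->
  exists g : I -> G, is_nilpotent_product r n g.
Proof.
move=> r1 n0 [psi [phi psiK phiK]].
have phiM := can2_gmulfM psiK phiK.
pose Phi : {multiplicative nilpotent_product (fun i => cyclic_group (r i)) n -> G} :=
  HB.pack phi (isMultiplicative.Build _ G phi phiM).
exists (fun i => Phi (np_gen r n i)); split.
- by move=> i; rewrite -homX np_gen_order // hom1.
- move=> x; rewrite -(psiK x).
  have := generated_image (f := Phi) (np_generated (psi x)); apply: generatedS.
  by move=> _ [_ [i _ <-] <-]; exists i.
- move=> x /(hom_gamma psi)/(np_class n0) /= psi1.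
  by rewrite /= -(psiK x) psi1; exact: (hom1 Phi).
move=> H h Hn hr; have [theta thetaE] := np_lift r1 Hn hr.
pose th : {multiplicative G -> H} := theta \o psi.
by exists th => i; rewrite /th /= phiK thetaE.
Qed.

Section Multiplier.
Variables (p n c t : nat) (alpha : 'I_t -> nat).
Hypotheses (p_prime : prime p) (n_gt0 : (0 < n)%N) (c_le_n : (c <= n)%N).
Hypotheses (p_large : (n + c < p)%N) (alpha_gt0 : forall i, (0 < alpha i)%N).
Variables (F G : groupType) (f : {multiplicative F -> G}).
Hypotheses (F_free : is_free_group F) (f_surj : forall y, exists x, f x = y).
Variables (g : 'I_t -> G) (y : 'I_t -> F).
Hypothesis presG : is_nilpotent_product (fun i => p ^ alpha i)%N n g.
Hypothesis yg : forall i, f (y i) = g i.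

Local Notation gamma := (lower_central F).
Local Notation R := (kernel f).
Let nR : is_normal R := is_normal_kernel f.
Local Notation Lam := (rel_gamma R).

Lemma gamma_kernel : gamma n.+1 `<=` R.
Proof. by move=> x /(hom_gamma f)/(nilprod_class presG). Qed.

Lemma generated_kernel : [set: F] `<=` generated_subgroup (Lam 1 `|` range y).
Proof.
move=> x _; have [S1 SM SV] := is_subgroup_generated (Lam 1 `|` range y).
have : (f @` generated_subgroup (range y)) (f x).
  have [C1 CM CV] := is_subgroup_generated (range y).
  apply: (nilprod_gen presG (f x)); split=> [|_ [i _ <-]]; last first.
    by exists (y i) => //; apply: sub_generated; exists i.
  split=> [|_ _ [a Ca <-] [b Cb <-]|_ [a Ca <-]].
  - by exists 1; rewrite ?hom1.
  - by exists (a * b); rewrite ?gmulfM //; exact: CM.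
  - by exists a^-1; rewrite ?homV //; exact: CV.
case=> z yz fzx; rewrite -(mulVKg z x); apply: SM.
  by move: yz; apply: generatedS => a ya; right.
apply: sub_generated; left; apply: (rel_gamma1 (R := R)).
by rewrite /kernel /preimage /= gmulfM homV fzx mulVg.
Qed.

(** The elements x such that mu x - 1 has no term of degree at most k,
    whatever the representation mu of F by power series that sends R into
    degree n.+1.  Such a mu sends [R, F, ..., F], with j copies of F, into
    degree n.+1 + j, because it raises the degree by one for each copy. *)
Definition magnus_small (k : nat) : set F :=
  [set x | forall (A : nzRingType) (mu : {multiplicative F -> magnus 'I_t A}),
     R `<=` mu @^-1` mdeg n.+1 -> mdeg k.+1 (mu x)].

Lemma magnus_small_group k : is_subgroup (magnus_small k).
Proof.
split=> [A mu _|a b sa sb A mu muR|a sa A mu muR];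
  have [[M1 MM MV] _] := @mdeg_normal 'I_t A k.+1.
- by rewrite hom1.
- by rewrite gmulfM; apply: MM; [exact: sa | exact: sb].
- by rewrite homV; apply: MV; exact: sa.
Qed.

Lemma gamma_magnus_small k : gamma k.+1 `<=` magnus_small k.
Proof. by move=> x /hom_gamma gx A mu _; apply: gamma_mdeg. Qed.

Lemma iter_commutator_magnus_small k j : (k <= n + j)%N ->
  iter_commutator j R `<=` magnus_small k.
Proof.
move=> knj x Cx A mu muR; have := hom_iter_commutator muR Cx.
move/(mdeg_iter_commutator (ltn0Sn n) (fun u => id)).
by apply: mdeg_le; rewrite addSn ltnS.
Qed.

Lemma rel_gamma_magnus_small k : (0 < k)%N -> Lam k `<=` magnus_small k.
Proof.
move=> k0 _ [a ga [b cb ->]]; have [_ sM _] := magnus_small_group k.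
apply: sM; first exact: gamma_magnus_small.
by apply: iter_commutator_magnus_small cb; lia.
Qed.

(** The leading form of the image of a Lyndon commutator is the Lie polynomial
    of its word. *)
Lemma lead_lyndon_comm (A : nzRingType) (good : pred 'I_t) (mu : {multiplicative F -> magnus 'I_t A}) w :
  (forall l, lead 1 (mu (y l)) (letter_series A good l)) ->
  lyndon w -> lead (size w) (mu (lyndon_comm y w)) (lie_poly A good w).
Proof.
move=> H; elim/(@lyndon_ind _ 'I_t): w / => [l|w Lw w1 Ll Lr IHl IHr].
  exact: H.
rewrite /lyndon_comm bracketE // lie_polyE // homR -{1}(std_cat w1) size_cat.
by apply: lead_comm => //; rewrite -neq_nil lyndon_neq0.
Qed.

(** Over the integers modulo p ^ e, the elements 1 + x l satisfy the relation
    of order p ^ alpha l up to degree n as soon as e <= alpha l, because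
    n < p; the other generators are sent to 1.  So G maps to the Magnus group
    truncated at degree n, and freeness of F lifts this map to the whole
    Magnus group. *)
Lemma magnus_exists e : (0 < e)%N ->
  exists mu : {multiplicative F -> magnus 'I_t 'Z_(p ^ e)},
    R `<=` mu @^-1` mdeg n.+1 /\
    forall l, lead 1 (mu (y l)) (letter_series 'Z_(p ^ e) (fun l => (e <= alpha l)%N) l).
Proof.
move=> e0; set A := 'Z_(p ^ e).
have pe1 : (1 < p ^ e)%N by rewrite -(exp1n e) ltn_exp2r // prime_gt1.
pose N := NormalSubgroup (@mdeg_normal 'I_t A n.+1).
pose h l : magnus 'I_t A := if (e <= alpha l)%N then magnus_gen A l else 1.
have hX l : quot_map N (h l) ^+ (p ^ alpha l) = 1.
  rewrite -homX; apply/quot_map_eq1; rewrite /h.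
  case: leqP => el; last by rewrite expg1n; case: (@mdeg_normal 'I_t A n.+1) => -[].
  apply: magnus_genX => i /andP[i0 ni].
  have /dvdnP[m ->] : (p ^ e %| 'C(p ^ alpha l, i))%N.
    apply: dvdn_trans (dvdn_bin_prime_power (alpha l) p_prime _); first exact: dvdn_exp2l.
    by rewrite i0; apply: leq_ltn_trans ni _; lia.
  by rewrite natrM pchar_Zp // mulr0.
have HN : lower_central (quot_group N) n.+1 `<=` [set 1].
  move=> x /(gamma_surj (f := quot_map N) (@quot_map_surj _ N))[u gu <-].
  by apply/quot_map_eq1; apply: gamma_mdeg gu.
have [theta thetaE] := nilprod_lift presG HN hX.
pose th : {multiplicative F -> quot_group N} := theta \o f.
have [mu muE] := free_lift (q := quot_map N) th F_free (@quot_map_surj _ N).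
exists mu; split=> [x Rx|l].
  apply/(quot_map_eq1 N); rewrite muE /th /=.
  by rewrite (Rx : f x = 1) hom1.
have : quot_map N (h l) = quot_map N (mu (y l)) by rewrite muE /th /= yg thetaE.
move/quot_mapP => /= hmu.
rewrite -(mulVKg (h l) (mu (y l))) -[letter_series _ _ _]addr0.
apply: lead_mul => //; last by apply: mdeg_lead; apply: mdeg_le hmu.
rewrite /h /letter_series; case: ifP => _; first exact: lead_gen.
exact: lead1.
Qed.

(** For a word w, take e to be its exponent: all letters of w survive in the
    representation modulo p ^ e, and the exponents of w are read off modulo
    p ^ e by comparing leading forms. *)
Lemma lyndon_prod_inj k (a b : @lyndon_word _ 'I_t k -> nat) : (0 < k)%N ->
  magnus_small k ((lyndon_prod y a)^-1 * lyndon_prod y b) ->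
  (forall w, a w < p ^ word_exp alpha (val (val w)))%N ->
  (forall w, b w < p ^ word_exp alpha (val (val w)))%N ->
  a =1 b.
Proof.
move=> k0 sab ap bp w; set e := word_exp alpha (val (val w)).
have [l lw lE] : exists2 l, l \in val (val w) & alpha l = e.
  by apply: word_exp_mem; rewrite -size_eq0 size_tuple -lt0n.
have e0 : (0 < e)%N by rewrite -lE.
have pe1 : (1 < p ^ e)%N by rewrite -(exp1n e) ltn_exp2r // prime_gt1.
have [mu [muR muy]] := magnus_exists e0.
pose good l := (e <= alpha l)%N; set A := 'Z_(p ^ e) in mu muR muy.
have lead_lprod (d : @lyndon_word _ 'I_t k -> nat) :
    lead k (mu (lyndon_prod y d)) (\sum_w lie_poly A good (val (val w)) *+ d w)%R.
  rewrite hom_prod; apply: lead_prod => // v; rewrite homX; apply: leadX => //.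
  by have := lead_lyndon_comm muy (valP v); rewrite size_tuple.
have [_ la] := lead_lprod a; have [_ lb] := lead_lprod b.
(* u and v agree in degree k, so their leading forms coincide *)
have muab := sab A mu muR; move: muab la lb.
rewrite gmulfM homV.
set u := mu (lyndon_prod y a); set v := mu (lyndon_prod y b) => uv la lb.
have polyE : (\sum_w lie_poly A good (val (val w)) *+ a w =
              \sum_w lie_poly A good (val (val w)) *+ b w)%R.
  apply/funext => z; case: (ltnP (size z) k.+1) => zk; last first.
    have hz (d : @lyndon_word _ 'I_t k -> nat) :
        (\sum_w lie_poly A good (val (val w)) *+ d w)%R z = 0%R.
      rewrite series_sum big1 // => x _; rewrite seriesMn (homog_lie_poly _ _ (valP x)).
        by rewrite mul0rn.
      by rewrite size_tuple neq_ltn zk orbT.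
    by rewrite !hz.
  have := la z zk; have := lb z zk; rewrite !seriesD !seriesN.
  have : (mval u - mval v = - (mval u * (mval (u^-1 * v)%g - 1)))%R.
    by rewrite mulrBr mulr1 mvalM mulrA mvalK mul1r opprB.
  move/(congr1 (fun s : series 'I_t A => s z)).
  rewrite seriesN (deg_geMl (mval u) uv zk) oppr0 seriesD seriesN => /eqP.
  rewrite subr_eq0 => /eqP ->.
  by move=> /eqP; rewrite subr_eq0 => /eqP <- /eqP; rewrite subr_eq0 => /eqP <-.
have := @lie_poly_free _ _ A good k a b polyE w.
have gw : all good (val (val w)) by apply/allP => x xw; exact: word_exp_le.
by move/(_ gw)/(congr1 val); rewrite /= !val_Zp_nat // !modn_small.
Qed.

Definition lyndon_exponents k :=
  {dffun forall w : @lyndon_word _ 'I_t k, 'I_(p ^ word_exp alpha (val (val w)))}.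

Lemma card_lyndon_exponents k :
  #|{: lyndon_exponents k}| = (p ^ \sum_(w : k.-tuple 'I_t | lyndon w) word_exp alpha w)%N.
Proof.
rewrite card_dep_ffun foldrE big_map big_enum /= expn_sum.
rewrite [RHS](reindex_omap (val : @lyndon_word _ 'I_t k -> k.-tuple 'I_t) insub); last first.
  by move=> w Lw; rewrite insubT.
apply: eq_big => [w|w _]; first by rewrite valK eqxx andbT (valP w).
by rewrite card_ord.
Qed.

Lemma collection_mod_relations k z : (0 < k)%N -> gamma k z ->
  exists a : lyndon_exponents k, Lam k ((lyndon_prod y (fun w => a w))^-1 * z).
Proof.
move=> k0.
have LN := rel_gamma_normal nR; have gL := @gamma_rel_gamma F R nR.
have LC := @rel_gamma_comm F R nR.
have q0 w : (0 < p ^ word_exp alpha w)%N by rewrite expn_gt0 prime_gt0.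
apply: (@collection _ _ F y Lam LN gL (@rel_gamma_sub F R) LC generated_kernel k
  (fun w => p ^ word_exp alpha w)%N k0 q0) => w Lw.
have [l lw lE] := word_exp_mem alpha (lyndon_neq0 Lw).
apply: (lyndon_comm_exp LN gL LC Lw lw).
apply: rel_gamma1; rewrite /kernel /preimage /= homX yg -lE.
exact: (nilprod_order presG).
Qed.

Local Notation K := (iter_commutator c R).
Local Notation pi := (quot_map (kernel_commutator f c)).

Lemma rel_gamma_split k z : (c < k)%N -> Lam k z ->
  exists2 u, gamma k.+1 u & K (u^-1 * z).
Proof.
case: k => // k ck [u gu [v cv ->]]; exists u => //; rewrite mulKg.
by apply: iter_commutator_le cv.
Qed.

Lemma K_sub_kernel : K `<=` R.
Proof. exact: iter_commutator_sub. Qed.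

(** An element z of R of weight k <= n has leading form 0 in degree k.  Hence
    all exponents of its collected form vanish, and z lies deeper by one up to
    relations, which belong to [R, F, ..., F] as soon as k > c. *)
Lemma kernel_deep k x : (c < k)%N -> (k <= n.+1)%N -> R x -> gamma c.+1 x ->
  exists2 z, R z & gamma k z /\ pi x = pi z.
Proof.
move=> + + Rx gx; elim: k => // k IH ck kn.
have [[r1 rM rV] _] := nR.
have [ck'|kc] := ltnP c k; last first.
  by exists x => //; split=> //; have -> : k.+1 = c.+1 by lia.
have k0 : (0 < k)%N by lia.
have [z Rz [gz ->]] := IH ck' (ltnW kn).
have [a az] := collection_mod_relations k0 gz.
have [s1 sM sV] := magnus_small_group k.
have sR : R `<=` magnus_small k.
  by apply: (@iter_commutator_magnus_small k 0); rewrite addn0 -ltnS.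
have sa : magnus_small k (lyndon_prod y (fun w => a w)).
  have := sM _ _ (sR _ Rz) (sV _ (rel_gamma_magnus_small k0 az)).
  by rewrite invgM invgK mulVKg.
have l0 : lyndon_prod y (fun _ : @lyndon_word _ 'I_t k => 0%N) = 1 by rewrite /lyndon_prod big1.
have aE : (fun _ => 0%N) =1 (fun w => a w : nat).
  apply: (lyndon_prod_inj k0) => [|w|w]; last exact: ltn_ord.
    by rewrite l0 invg1 mul1g.
  by rewrite expn_gt0 prime_gt0.
have {}az : Lam k z.
  have : lyndon_prod y (fun w => a w) = 1 by rewrite -l0 /lyndon_prod; apply: eq_bigr => w _; rewrite -aE.
  by move=> a1; move: az; rewrite a1 invg1 mul1g.
have [u gu Kuz] := rel_gamma_split ck' az.
exists u; last by split=> //; apply/esym/(quot_mapP (kernel_commutator f c)).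
by have := rV _ (rM _ _ (K_sub_kernel Kuz) (rV _ Rz)); rewrite mulgK invgK.
Qed.

(** The multiplier is the term n.+1 of the lower central series of
    F / [R, F, ..., F]. *)
Lemma multiplier_gamma : nilpotent_multiplier f c = pi @` gamma n.+1.
Proof.
apply/seteqP; split=> [_ [x [Rx gx] <-]|_ [x gx <-]].
  have cn : (c < n.+1)%N by [].
  by have [z _ [gz ->]] := kernel_deep cn (leqnn _) Rx gx; exists z.
by exists x => //; split; [exact: gamma_kernel | apply: gamma_leq gx].
Qed.

(** R contains the term n.+1, so [R, F, ..., F] contains the term
    n + c + 1. *)
Lemma gamma_last x : gamma (n + c).+1 x -> K x.
Proof.
rewrite /lower_central /= addnC /iter_commutator iterD -/(iter_commutator _ _).
exact: (@iter_commutatorS _ c _ _ gamma_kernel).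
Qed.

(** Collection represents the factor of weight k by exponents, and the
    representations by power series separate these exponents. *)
Lemma enumerates_gamma_step k N : (c < k)%N -> (k <= n + c)%N ->
  enumerates (pi @` gamma k.+1) N ->
  enumerates (pi @` gamma k) (#|{: lyndon_exponents k}| * N).
Proof.
move=> ck knc EN; have k0 : (0 < k)%N by lia.
have [s1 sM sV] := magnus_small_group k.
apply: (enumerates_step (h := fun a : lyndon_exponents k => pi (lyndon_prod y (fun w => a w))) EN).
  move=> x; split=> [[z gz <-]|[a [_ [u gu <-] ->]]]; last first.
    rewrite -gmulfM; exists (lyndon_prod y (fun w => a w) * u) => //.
    have [_ gM _] := gamma_group F k; apply: gM; first exact: lyndon_prod_gamma.
    exact: gamma_leq gu.
  have [a az] := collection_mod_relations k0 gz; exists a.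
  have [u gu Ku] := rel_gamma_split ck az.
  exists (pi u); first by exists u.
  rewrite -gmulfM; apply/esym/(quot_mapP (kernel_commutator f c)).
  by rewrite invgM -mulgA.
move=> a b _ _ [u gu <-] [v gv <-]; rewrite -!gmulfM => /quot_mapP /= Kab.
suff ab : (fun w => a w : nat) =1 (fun w => b w : nat).
  by apply/ffunP => w; apply: val_inj; exact: ab.
apply: (lyndon_prod_inj k0) => [|w|w]; [|exact: ltn_ord|exact: ltn_ord].
have sK : K `<=` magnus_small k := iter_commutator_magnus_small knc.
move/sK: Kab; rewrite invgM => Kab.
have -> : (lyndon_prod y (fun w => a w))^-1 * lyndon_prod y (fun w => b w) =
  u * (u^-1 * (lyndon_prod y (fun w => a w))^-1 * (lyndon_prod y (fun w => b w) * v)) * v^-1.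
  by rewrite !mulgA mulgV mul1g mulgK.
have gs := @gamma_magnus_small k.
exact: (sM _ _ (sM _ _ (gs _ gu) Kab) (sV _ (gs _ gv))).
Qed.

Lemma enumerates_multiplier : enumerates (nilpotent_multiplier f c)
  (p ^ \sum_(1 <= i < c.+1) \sum_(w : (n + i).-tuple 'I_t | lyndon w) word_exp alpha w)%N.
Proof.
rewrite multiplier_gamma.
pose S k := (\sum_(w : k.-tuple 'I_t | lyndon w) word_exp alpha w)%N.
suff H d i : (i + d)%N = c ->
    enumerates (pi @` gamma (n + i).+1) (p ^ \sum_(i.+1 <= l < c.+1) S (n + l)%N).
  by have := H c 0%N (add0n c); rewrite addn0.
elim: d i => [|d IH] i ic.
  rewrite (_ : i = c) ?big_geq //; last by rewrite -ic addn0.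
  exists (fun _ => 1); split=> [x z _|]; first by rewrite !ord1.
  apply/seteqP; split=> [_ [_ _ <-]|_ [x gx <-]].
    by exists 1; [case: (gamma_group F (n + c).+1) | exact: hom1].
  by exists ord0 => //; apply/esym/quot_map_eq1; exact: gamma_last.
have ic' : (i < c)%N by rewrite -ic addnS ltnS leq_addr.
rewrite big_ltn ?ltnS // expnD -card_lyndon_exponents -addnS.
apply: enumerates_gamma_step.
- by rewrite addnS ltnS; apply: leq_trans c_le_n (leq_addr _ _).
- by rewrite leq_add2l.
- by apply: IH; rewrite addSn -addnS.
Qed.

End Multiplier.

(** Each Lyndon word w of length n + 1, ..., n + c on t letters contributes a
    factor p ^ word_exp alpha w. *)
Theorem card_nilpotent_multiplier (p n c t : nat) (alpha : 'I_t -> nat) (F G : groupType)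
    (f : {multiplicative F -> G}) :
  prime p -> (0 < n)%N -> (c <= n)%N -> (n + c < p)%N -> (forall i, (0 < alpha i)%N) ->
  is_free_group F -> (forall y, exists x, f x = y) ->
  isomorphic G (nilpotent_product (fun i => cyclic_group (p ^ alpha i)) n) ->
  (nilpotent_multiplier f c #=
    `I_(p ^ \sum_(1 <= i < c.+1) \sum_(w : (n + i).-tuple 'I_t | lyndon w) word_exp alpha w))%card.
Proof.
move=> pp n0 cn ncp a0 Ffree fs Giso.
have r1 i : (1 < p ^ alpha i)%N by rewrite -(exp1n (alpha i)) ltn_exp2r // prime_gt1.
have [g presG] := isomorphic_nilpotent_product r1 n0 Giso.
have [y yg] := choice (fun i => fs (g i)).
exact/enumerates_card/(enumerates_multiplier pp n0 cn ncp a0 Ffree presG yg).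
Qed.

End NilpotentMultiplier.

Local Open Scope nat_scope.
Local Open Scope card_scope.
Local Open Scope classical_set_scope.

Theorem theorem3p3 (p n c t : nat) (alpha : 'I_t -> nat)
    (p_prime : prime p) (n_ge1 : 1 <= n) (c_ge1 : 1 <= c) (t_ge1 : 1 <= t)
    (c_le_n : c <= n)
    (alpha_decr : forall i j : 'I_t, i <= j -> alpha j <= alpha i)
    (alpha_ge1 : forall i : 'I_t, 1 <= alpha i)
    (coprime_p : forall q : nat, prime q -> q <= n + c -> coprime q p)
    (G : groupType)
    (G_iso : isomorphic G
       (nilpotent_product (fun i : 'I_t => cyclic_group (p ^ alpha i)) n))
    (F : groupType) (F_free : is_free_group F)
    (f : {multiplicative F -> G}) (f_surj : forall y : G, exists x : F, f x = y) :
  let m := \sum_(i < t) alpha i in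
  let g_m := \sum_(1 <= i < c.+1) witt (n + i) m in
  nilpotent_multiplier f c #= `I_(p ^ g_m) <->
  isomorphic G (nilpotent_product (fun _ : 'I_m => cyclic_group p) n).
Proof.
move=> m g_m.
have p_large : n + c < p.
  rewrite ltnNge; apply/negP => /(coprime_p p p_prime).
  by rewrite /coprime gcdnn => /eqP p1; rewrite p1 in p_prime.
split=> [card_gm|Giso]; last first.
  have := card_nilpotent_multiplier (alpha := fun _ : 'I_m => 1) p_prime n_ge1 c_le_n
    p_large (fun=> isT) F_free f_surj Giso.
  rewrite /g_m (eq_big_nat _ _ (F2 := fun i => witt (n + i) m)) // => i /andP[i0 _].
  by rewrite sum_word_exp1 // addn_gt0 n_ge1.
(* an exponent alpha i > 1 would make the multiplier of G too small *)
have alpha1 : alpha = fun=> 1.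
  apply/funext => i; apply/eqP; rewrite eqn_leq alpha_ge1 andbT leqNgt.
  apply/negP => ai.
  have := card_nilpotent_multiplier p_prime n_ge1 c_le_n p_large alpha_ge1 F_free f_surj G_iso.
  move/(card_eq_trans (card_esym card_gm))/card_eq_II/eqP.
  rewrite eqn_exp2l ?prime_gt1 // => /eqP E.
  suff : \sum_(1 <= i < c.+1) \sum_(w : (n + i).-tuple 'I_t | lyndon w) word_exp alpha w < g_m.
    by rewrite -E ltnn.
  have lt_witt k : 0 < k -> \sum_(w : (n + k).-tuple 'I_t | lyndon w) word_exp alpha w
      < witt (n + k) m.
    by move=> k0; apply: (sum_word_exp_lt _ ai); lia.
  rewrite /g_m !(big_ltn (m := 1)) ?ltnS // -addSn; apply: leq_add; first exact: lt_witt.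
  rewrite big_nat [leqRHS]big_nat; apply: leq_sum => k /andP[k0 _].
  by apply/ltnW/lt_witt; lia.
have mt : m = t by rewrite /m alpha1 sum1_card card_ord.
by rewrite mt; move: G_iso; rewrite alpha1.
Qed.
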